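(* For every fixed $c\ge1$ there is a constant $C_c$ (depending only on $c$) such that, for every $n\ge2$, all positive edge activities $\lambda$ and every set of $c$-rough hole weights $w$, $$\tau_{\mathrm{rel}}\bigl(P_{\mathrm{HWS}}(\lambda,w)\bigr)\le C_c\,n^2\log n .$$
   Context: Let $V_1,V_2$ be disjoint sets with $|V_1|=|V_2|=n$. In the complete bipartite graph on $(V_1,V_2)$ let $\mathcal P$ be the set of perfect matchings, let $\mathcal N(u,v)$ (for $(u,v)\in V_1\times V_2$) be the set of matchings with $n-1$ edges whose unmatched vertices (holes) are exactly $u$ and $v$, and let $\Omega=\mathcal P\cup\bigcup_{u,v}\mathcal N(u,v)$. Positive edge activities are a function $\lambda:V_1\times V_2\to(0,\infty)$; put $\lambda(M)=\prod_{e\in M}\lambda(e)$ and $\lambda(S)=\sum_{M\in S}\lambda(M)$ for $S\subseteq\Omega$. Ideal hole weights: $w^*(u,v)=\lambda(\mathcal P)/\lambda(\mathcal N(u,v))$. Positive hole weights $w:V_1\times V_2\to(0,\infty)$ are $c$-rough if $c^{-1}\le w(u,v)/w^*(u,v)\le c$ for all $(u,v)$. Hole-weighted slide (HWS) chain. For distinct $v,a\in V_2$ and distinct $u,x\in V_1$ let $L_v(a)=\bigl(\sum_{z\in V_1}\lambda(z,a)/w(z,v)\bigr)^{-1}$, $R_u(x)=\bigl(\sum_{b\in V_2}\lambda(x,b)/w(u,b)\bigr)^{-1}$, and $L_v(v)=R_u(u)=0$. Let $D^L(u,v)=\sum_{a\in V_2\setminus\{v\}}\lambda(u,a)L_v(a)$,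 $D^R(u,v)=\sum_{x\in V_1\setminus\{u\}}\lambda(x,v)R_u(x)$, and $W(u,v)=w(u,v)+n\lambda(u,v)+D^L(u,v)+D^R(u,v)$. The transition matrix $P_{\mathrm{HWS}}=P_{\mathrm{HWS}}(\lambda,w)$ on $\Omega$ has non-loop transitions: - for $M\in\mathcal P$, $(u,v)\in M$: $P_{\mathrm{HWS}}(M,M\setminus\{(u,v)\})=\frac1{2n}$; - for $N\in\mathcal N(u,v)$: $P_{\mathrm{HWS}}(N,N\cup\{(u,v)\})=\frac{n\lambda(u,v)}{2W(u,v)}$; - for $N\in\mathcal N(u,v)$, $(x,a)\in N$: $P_{\mathrm{HWS}}(N,N\setminus\{(x,a)\}\cup\{(u,a)\})=\frac{\lambda(u,a)L_v(a)}{2W(u,v)}$ and $P_{\mathrm{HWS}}(N,N\setminus\{(x,a)\}\cup\{(x,v)\})=\frac{\lambda(x,v)R_u(x)}{2W(u,v)}$; all other non-loop probabilities are zero, with the remaining probability on the self-loop. The chain is lazy, irreducible, and reversible with respect to $\pi^{\mathrm{HWS}}_{\lambda,w}$, the probability distribution on $\Omega$ proportional to $n^2\lambda(M)$ for $M\in\mathcal P$ and $W(u,v)\lambda(M)$ for $M\in\mathcal N(u,v)$. Relaxation time: for a reversible irreducible chain $P$ with stationary distribution $\pi$, $\tau_{\mathrm{rel}}(P)$ is the smallest $C>0$ with $\operatorname{Var}_\pi[f]\le C\,\mathcal E_P(f,f)$ for all $f:\Omega\to\mathbb R$, where $\mathcal E_P(f,f)=\frac12\sum_{x,y}\pi(x)P(x,y)(f(x)-f(y))^2$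 (i.e. the inverse spectral gap). *)

(* Defs.v *)
From HB Require Import structures.
From mathcomp Require Import all_boot all_order all_algebra.
From mathcomp Require Import reals exp.
Set Implicit Arguments.
Unset Strict Implicit.
Unset Printing Implicit Defensive.
Import Order.TTheory GRing.Theory Num.Theory.
Local Open Scope ring_scope.

Section RelaxationTime.
Variables (R : realType) (T : finType).
Implicit Types (pi f : T -> R) (P : T -> T -> R).

Definition mean pi f : R := \sum_x pi x * f x.

Definition variance pi f : R := \sum_x pi x * (f x - mean pi f) ^+ 2.

Definition dirichlet pi P f : R :=
  2^-1 * \sum_x \sum_y pi x * P x y * (f x - f y) ^+ 2.

Definition poincare pi P (C : R) : Prop :=
  forall f, variance pi f <= C * dirichlet pi P f.

(* A predicate rather than a total function, so that no junk value is assigned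
   to chains that satisfy no Poincare inequality. *)
Definition is_relaxation_time pi P (tau : R) : Prop :=
  [/\ 0 < tau, poincare pi P tau
    & forall C : R, 0 < C -> poincare pi P C -> tau <= C].

End RelaxationTime.

(* V1 and V2 are separate types, hence automatically disjoint.  An edge set of
   the complete bipartite graph is a subset of V1 * V2. *)
Section Matchings.
Variables V1 V2 : finType.
Implicit Type M : {set V1 * V2}.

Definition matching M : bool :=
  [forall e in M, forall f in M, ((e.1 == f.1) || (e.2 == f.2)) ==> (e == f)].

Definition holes1 M : {set V1} := ~: [set e.1 | e in M].
Definition holes2 M : {set V2} := ~: [set e.2 | e in M].

Definition perfect : {set {set V1 * V2}} :=
  [set M | [&& matching M, holes1 M == set0 & holes2 M == set0]].

Definition near_perfect (u : V1) (v : V2) : {set {set V1 * V2}} :=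
  [set M | [&& matching M, #|M| == #|V1|.-1,
               holes1 M == [set u] & holes2 M == [set v]]].

Definition Omega : {set {set V1 * V2}} :=
  perfect :|: \bigcup_u \bigcup_v near_perfect u v.

Definition state : finType := {M : {set V1 * V2} | M \in Omega}.

End Matchings.

Section HWS.
Variables (R : realType) (V1 V2 : finType).
Variables lam w : V1 -> V2 -> R.
Implicit Types (M : {set V1 * V2}) (u x : V1) (v a : V2).

(* The common size of V1 and V2. *)
Local Notation n := (#|V1|%:R : R).

Definition activity M : R := \prod_(e in M) lam e.1 e.2.

Definition set_activity (S : {set {set V1 * V2}}) : R :=
  \sum_(M in S) activity M.

Definition ideal_weight u v : R :=
  set_activity (perfect V1 V2) / set_activity (near_perfect u v).

Definition rough (c : R) : Prop :=
  forall u v, c^-1 <= w u v / ideal_weight u v <= c.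

Definition Lw v a : R :=
  if a == v then 0 else (\sum_z lam z a / w z v)^-1.

Definition Rw u x : R :=
  if x == u then 0 else (\sum_b lam x b / w u b)^-1.

Definition DL u v : R := \sum_(a | a != v) lam u a * Lw v a.

Definition DR u v : R := \sum_(x | x != u) lam x v * Rw u x.

Definition W u v : R := w u v + n * lam u v + DL u v + DR u v.

(* Every sum below is over moves, filtered by the move leading from M to M';
   distinct moves out of M lead to distinct states. *)
Definition rate_perfect M M' : R :=
  \sum_(e in M | M' == M :\ e) (2 * n)^-1.

Definition rate_near u v M M' : R :=
    (if M' == (u, v) |: M then n * lam u v / (2 * W u v) else 0)
  + \sum_(e in M | M' == (u, e.2) |: (M :\ e))
      lam u e.2 * Lw v e.2 / (2 * W u v)
  + \sum_(e in M | M' == (e.1, v) |: (M :\ e))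
      lam e.1 v * Rw u e.1 / (2 * W u v).

(* For M in Omega exactly one of the two cases applies, and in the second one
   the double sum has a single nonzero term, given by the holes of M. *)
Definition rate M M' : R :=
  if M \in perfect V1 V2 then rate_perfect M M'
  else \sum_u \sum_(v | M \in near_perfect u v) rate_near u v M M'.

Definition P_HWS (M M' : state V1 V2) : R :=
  if M' == M then 1 - \sum_(M'' : state V1 V2 | M'' != M) rate (val M) (val M'')
  else rate (val M) (val M').

Definition HWS_weight M : R :=
  if M \in perfect V1 V2 then n ^+ 2 * activity M
  else \sum_u \sum_(v | M \in near_perfect u v) W u v * activity M.

Definition pi_HWS (M : state V1 V2) : R :=
  HWS_weight (val M) / \sum_(M' : state V1 V2) HWS_weight (val M').

End HWS.

(* Main.v *)
Require Import Defs.
From HB Require Import structures.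
From mathcomp Require Import all_boot all_order all_algebra.
From mathcomp Require Import reals exp.
From mathcomp Require Import all_fingroup ring lra zify.
Set Implicit Arguments.
Unset Strict Implicit.
Unset Printing Implicit Defensive.
Import Order.TTheory GRing.Theory Num.Theory.
Local Open Scope ring_scope.

(* Identify V2 with V1.  A perfect matching becomes a permutation s, and a
   near-perfect matching with holes (u, s u) becomes the pair (s, u): the matching
   s without its edge at u.  Both kinds of slide multiply s by the transposition
   tperm u x; the left slide moves the marked vertex to x, the right one keeps it.

   For a pair (s, t) of perfect matchings the alternating cycles of s and t are
   the cycles of r = t * s^-1, and swapping s and t on one cycle is a
   weight-preserving involution.  These involutions commute, so (f s - f t)^2 is
   on average at most the sum over the cycles of the squared change of f under a
   single swap: there is no loss for the number of cycles.  A single swap on a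
   cycle of length l through u is performed by opening the edge at u, sliding the
   hole l - 1 times and closing; this costs a factor l + 1 by Cauchy-Schwarz, which
   is paid for by averaging over the l choices of u.  Near-perfect matchings are
   coupled to perfect ones by the same sliding paths, now of length at most n.

   The slide step is a weight-preserving bijection on pairs of matchings, so the
   load of a slide from a matching N with right hole v along the edge at b is the
   weight of N times that of matchings with holes (u, b).  It is bounded by the
   exchange inequality T_v(b) N(u, b) <= 2 per(lam) N(u, v), where T_v(b) is the
   permanent of lam with column v replaced by column b; this in turn follows by
   swapping on one cycle.  The bound obtained is 128 c^2 n^2, without the
   logarithm. *)

(** * Swapping two permutations on a cycle *)

Section CycleSwap.
Variable V : finType.
Implicit Types (p : {perm V} * {perm V}) (s t : {perm V}) (S O : {set V}).
Implicit Types (Q : {set {set V}}) (x y u v : V).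

Definition relp p : {perm V} := (p.2 * p.1^-1)%g.

(** For the natural action ['P] the normaliser of [S] is its setwise stabiliser, so the stable sets
    are the unions of cycles of [relp p]. [restr_permE] asks for this form. *)
Definition stable S p := relp p \in 'N(S | 'P)%g.

(** Products act from left to right: on stable [S] the factor [restr_perm] turns the values of [s]
    into those of [t], and it is the identity off [S]. *)
Definition mix S s t : {perm V} := (restr_perm S (t * s^-1) * s)%g.

Definition swap S p := (mix S p.1 p.2, mix S p.2 p.1).

Lemma relpE p x : relp p x = p.1^-1%g (p.2 x).
Proof. by rewrite permM. Qed.

Lemma relpK p x : p.1 (relp p x) = p.2 x.
Proof. by rewrite relpE permKV. Qed.

Lemma stableP S p : reflect (forall x, (relp p x \in S) = (x \in S)) (stable S p).
Proof. by apply: (iffP astabsP) => h x; have := h x. Qed.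

Lemma mixE S s t x :
  stable S (s, t) -> mix S s t x = if x \in S then t x else s x.
Proof.
move=> nS; rewrite permM; case: ifP => xS; last first.
  by rewrite (out_perm (restr_perm_on _ _)) ?xS.
by rewrite restr_permE //= permM permKV.
Qed.

Lemma stable_sym S s t : stable S (s, t) = stable S (t, s).
Proof. by rewrite /stable -groupV /relp /= invMg invgK. Qed.

Lemma swapE1 S p x : stable S p -> (swap S p).1 x = if x \in S then p.2 x else p.1 x.
Proof. by case: p => s t; exact: mixE. Qed.

Lemma swapE2 S p x : stable S p -> (swap S p).2 x = if x \in S then p.1 x else p.2 x.
Proof. by case: p => s t /= nS; rewrite mixE // stable_sym. Qed.

Lemma relp_swap S p x : stable S p ->
  relp (swap S p) x = if x \in S then (relp p)^-1%g x else relp p x.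
Proof.
move=> nS; set y := (X in _ = X).
suff e : (swap S p).1 y = (swap S p).2 x by rewrite relpE -e permK.
rewrite swapE1 // swapE2 // {}/y; have [xS|xS] := boolP (x \in S).
  have -> : ((relp p)^-1%g x \in S) by rewrite -(stableP _ _ nS) permKV.
  by rewrite -relpK permKV.
by rewrite (stableP _ _ nS) (negPf xS) relpK.
Qed.

Lemma stable_swap S p S' : stable S p -> stable S' p -> stable S' (swap S p).
Proof.
move=> nS nS'; apply/stableP => x; rewrite relp_swap //; case: ifP => _.
  by rewrite -(stableP _ _ nS') permKV.
exact: (stableP _ _ nS').
Qed.

Lemma swapK S p : stable S p -> swap S (swap S p) = p.
Proof.
move=> nS; have nS' := stable_swap nS nS.
rewrite [LHS]surjective_pairing [RHS]surjective_pairing.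
congr pair; apply/permP => x; rewrite !(swapE1, swapE2) //; by case: (x \in S).
Qed.

Lemma stable_porbit p u : stable (porbit (relp p) u) p.
Proof.
apply/stableP => x; rewrite -!eq_porbit_mem.
by have := porbit_perm (relp p) 1 x; rewrite expg1 => ->.
Qed.

Lemma porbit_sub (r r' : {perm V}) : (forall x, r' x \in porbit r x) ->
  forall u, porbit r' u \subset porbit r u.
Proof.
move=> h u; apply/subsetP => y /porbitP [i ->]; elim: i => [|i IH].
  by rewrite perm1 porbit_id.
move: IH; rewrite -!eq_porbit_mem => /eqP <-.
by rewrite expgSr permM eq_porbit_mem.
Qed.

(** By [relp_swap] a swap reverses the cycles inside [S] and leaves the others alone, so their
    vertex sets survive. The converse inclusion comes from swapping back. *)
Lemma porbit_swap S p u : stable S p -> porbit (relp (swap S p)) u = porbit (relp p) u.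
Proof.
move=> nS.
have sub q : stable S q -> porbit (relp (swap S q)) u \subset porbit (relp q) u.
  move=> nq; apply: porbit_sub => x; rewrite relp_swap //; case: ifP => _.
    by rewrite -porbitV; have := mem_porbit (relp q)^-1%g 1 x; rewrite expg1.
  by have := mem_porbit (relp q) 1 x; rewrite expg1.
apply/eqP; rewrite eqEsubset sub //= -{1}(swapK nS) sub //.
exact: stable_swap.
Qed.

Lemma porbits_swap S p : stable S p -> porbits (relp (swap S p)) = porbits (relp p).
Proof. by move=> nS; apply: eq_imset => u; exact: porbit_swap. Qed.

Lemma swapU S S' p : stable S p -> stable S' p -> [disjoint S & S'] ->
  swap S (swap S' p) = swap (S :|: S') p.
Proof.
move=> nS nS' dis; have nS2 := stable_swap nS' nS.
have nU : stable (S :|: S') p.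
  by apply/stableP => x; rewrite !inE (stableP _ _ nS) (stableP _ _ nS').
rewrite [LHS]surjective_pairing [RHS]surjective_pairing.
congr pair; apply/permP => x; rewrite !(swapE1, swapE2) // inE; case: ifP => // xS;
  by rewrite (disjointFr dis xS).
Qed.

(** [Q] is fixed independently of [p], and only those members that are cycles of [p] are used. Thus
    [cswap Q] is a single involution on all pairs, available for reindexing sums. *)
Definition cycles Q p := cover (Q :&: porbits (relp p)).

Definition cswap Q p := swap (cycles Q p) p.

Lemma stable_cycles Q p : stable (cycles Q p) p.
Proof.
apply/stableP => x; apply/bigcupP/bigcupP => -[O]; rewrite !inE => /andP[QO /imsetP[u _ Ou]] xO;
  exists O; rewrite ?inE ?QO ?Ou ?imset_f //.
  by rewrite -(stableP _ _ (stable_porbit p u)) -Ou.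
by rewrite (stableP _ _ (stable_porbit p u)) -Ou.
Qed.

Lemma cycles_swap S Q p : stable S p -> cycles Q (swap S p) = cycles Q p.
Proof. by move=> nS; rewrite /cycles porbits_swap. Qed.

Lemma cswapK Q : involutive (cswap Q).
Proof.
move=> p; have nQ := stable_cycles Q p.
by rewrite /cswap cycles_swap // swapK.
Qed.

Lemma cyclesU Q Q' p : cycles (Q :|: Q') p = cycles Q p :|: cycles Q' p.
Proof. by rewrite /cycles setIUl /cover bigcup_setU. Qed.

Lemma cycles_disjoint Q Q' p : [disjoint Q & Q'] -> [disjoint cycles Q p & cycles Q' p].
Proof.
move=> dis; apply/pred0P => x /=; apply/negP => /andP[/bigcupP[O]].
rewrite inE => /andP[QO /imsetP[u _ Ou]] xO /bigcupP[O'].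
rewrite inE => /andP[QO' /imsetP[u' _ Ou']] xO'.
suff E : O = O' by move: QO'; rewrite -E (disjointFr dis QO).
by move: xO xO'; rewrite Ou Ou' -!eq_porbit_mem => /eqP<- /eqP<-.
Qed.

Lemma cswapU Q Q' p : [disjoint Q & Q'] -> cswap Q (cswap Q' p) = cswap (Q :|: Q') p.
Proof.
move=> dis; rewrite /cswap cycles_swap; last exact: stable_cycles.
by rewrite swapU ?cyclesU ?cycles_disjoint //; exact: stable_cycles.
Qed.

Lemma cswapT p : cswap setT p = (p.2, p.1).
Proof.
have cT x : x \in cycles setT p.
  apply/bigcupP; exists (porbit (relp p) x); last exact: porbit_id.
  by rewrite inE inE imset_f.
rewrite [LHS]surjective_pairing.
congr pair; apply/permP => x; rewrite !(swapE1, swapE2) ?cT //; exact: stable_cycles.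
Qed.

Lemma cswap1 O p :
  cswap [set O] p = if O \in porbits (relp p) then swap O p else p.
Proof.
rewrite /cswap /cycles; case: ifP => hO.
  by rewrite (setIidPl _) ?sub1set // /cover big_set1.
have -> : [set O] :&: porbits (relp p) = set0.
  by apply/eqP; rewrite setI_eq0 disjoints1 hO.
rewrite /cover big_set0.
have n0 : stable set0 p by apply/stableP => x; rewrite !inE.
by rewrite [LHS]surjective_pairing [RHS]surjective_pairing;
  congr pair; apply/permP => x; rewrite !(swapE1, swapE2) // inE.
Qed.

(** A transposition splits the cycle containing both points or merges their two cycles. Counting
    cycles before and after, for [s] and for [tperm x y * s], shows that exactly one of the two
    cases occurs. *)
Lemma porbit_mul_tperm s x y : x != y ->
  (x \in porbit (tperm x y * s)%g y) = (x \notin porbit s y).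
Proof.
move=> xy; have := porbits_mul_tperm s x y; have := porbits_mul_tperm (tperm x y * s)%g x y.
rewrite /= mulgA tperm2 mul1g xy /=.
by do 2 case: (x \in _) => /=; rewrite ?addn0 ?addn1 ?double0 //= => h1 h2; lia.
Qed.

(** A cycle of length l is reached from each of its l vertices, each time with weight 1/l. *)
Lemma sum_porbits (R : numFieldType) (r : {perm V}) (g : {set V} -> R) :
  \sum_(O in porbits r) g O = \sum_u (#|porbit r u|%:R)^-1 * g (porbit r u).
Proof.
rewrite (partition_big (porbit r) (mem (porbits r))) /=; last by move=> u _; exact: imset_f.
apply: eq_bigr => O /imsetP[u _ ->].
under eq_bigr => x /eqP-> do [].
rewrite sumr_const (eq_card (B := porbit r u)); last first.
  by move=> x; rewrite -eq_porbit_mem.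
rewrite -mulrnAl -[X in X * _](mulr_natl) mulfV ?mul1r //.
by rewrite pnatr_eq0 card_porbit_neq0.
Qed.

End CycleSwap.

(** * Exchange inequalities *)

Section Permanents.
Variables (R : realFieldType) (V : finType).
Implicit Types (a b : V -> V -> R) (s t : {perm V}) (p : {perm V} * {perm V}).

Definition diag_prod a s : R := \prod_x a x (s x).

Definition permanent a : R := \sum_s diag_prod a s.

Definition set_row a y (r : V -> R) x : V -> R := if x == y then r else a x.

Lemma eq_permanent a b : a =2 b -> permanent a = permanent b.
Proof. by move=> ab; apply: eq_bigr => s _; apply: eq_bigr => x _. Qed.

Lemma diag_prod_ge0 a s : (forall x y, 0 <= a x y) -> 0 <= diag_prod a s.
Proof. by move=> a0; apply: prodr_ge0. Qed.

Lemma permanentM a b :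
  permanent a * permanent b = \sum_p diag_prod a p.1 * diag_prod b p.2.
Proof. by rewrite big_distrlr /= pair_bigA. Qed.

Lemma diag_prod_swap a b (S : {set V}) p : stable S p ->
  diag_prod a (swap S p).1 * diag_prod b (swap S p).2 =
  \prod_x (if x \in S then a x (p.2 x) * b x (p.1 x)
           else a x (p.1 x) * b x (p.2 x)).
Proof.
move=> nS; rewrite -big_split /=; apply: eq_bigr => x _.
have e1 := swapE1 x nS; have e2 := swapE2 x nS; rewrite /= in e1 e2.
by rewrite e1 e2; case: ifP.
Qed.

Lemma diag_prod_swap_id a (S : {set V}) p : stable S p ->
  diag_prod a (swap S p).1 * diag_prod a (swap S p).2 =
  diag_prod a p.1 * diag_prod a p.2.
Proof.
move=> nS; rewrite diag_prod_swap // -big_split /=; apply: eq_bigr => x _.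
by case: ifP; rewrite // mulrC.
Qed.

Definition swap_at x p := swap (porbit (relp p) x) p.

Lemma swap_atK x : involutive (swap_at x).
Proof.
move=> p; rewrite /swap_at porbit_swap ?swapK //; exact: stable_porbit.
Qed.

Lemma relp_swap_at x y z p :
  (y \in porbit (relp (swap_at x p)) z) = (y \in porbit (relp p) z).
Proof. by rewrite porbit_swap //; exact: stable_porbit. Qed.

(** The swap on the cycle of [x] is an involution preserving the condition on [y]. It trades the
    rows [x] of [a] and [b]; on the other rows of that cycle the two matrices agree, since [y] is
    not among them. The remaining pairs on the right are nonnegative. *)
Lemma exchange_apart a b x y :
  (forall z z', 0 <= a z z') -> (forall z z', 0 <= b z z') ->
  (forall z, z != x -> z != y -> a z =1 b z) ->
  \sum_(p | y \notin porbit (relp p) x) diag_prod a p.1 * diag_prod b p.2 <=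
  permanent (set_row a x (b x)) * permanent (set_row b x (a x)).
Proof.
move=> a0 b0 ab; rewrite permanentM (reindex_inj (inv_inj (swap_atK x))) /=.
rewrite [X in _ <= X](bigID (fun p => y \notin porbit (relp p) x)) /=.
have s0 c z r : (forall z z', 0 <= c z z') -> (forall z', 0 <= r z') ->
  forall z1 z2, 0 <= @set_row c z r z1 z2.
  by move=> c0 r0 z1 z2; rewrite /set_row; case: ifP.
rewrite ler_wpDr //.
  by apply: sumr_ge0 => p _; rewrite mulr_ge0 ?diag_prod_ge0 //; apply: s0.
rewrite le_eqVlt; apply/orP; left; apply/eqP; apply: eq_big => [p|p].
  by rewrite relp_swap_at.
rewrite relp_swap_at => yS; rewrite diag_prod_swap; last exact: stable_porbit.
rewrite -big_split /=; apply: eq_bigr => z _; rewrite /set_row.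
have [->|zx] := eqVneq z x; first by rewrite porbit_id mulrC.
case: ifP => // zS.
have zy : z != y by apply: contraNneq yS => <-.
by rewrite mulrC !ab.
Qed.

Lemma exchange a b x y : x != y ->
  (forall z z', 0 <= a z z') -> (forall z z', 0 <= b z z') ->
  (forall z, z != x -> z != y -> a z =1 b z) ->
  permanent a * permanent b <=
  permanent (set_row a x (b x)) * permanent (set_row b x (a x)) +
  permanent (set_row a x (b y)) *
  permanent (set_row (fun z => b (tperm x y z)) x (a x)).
Proof.
move=> xy a0 b0 ab.
rewrite [X in X <= _]permanentM (bigID (fun p => y \notin porbit (relp p) x)) /=.
apply: lerD; first exact: exchange_apart.
pose tw p := (p.1, (tperm x y * p.2)%g).
have twK : involutive tw by move=> [s t]; rewrite /tw /= mulgA tperm2 mul1g.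
rewrite (reindex_inj (inv_inj twK)) /=.
have -> : b y = b (tperm x y x) by rewrite tpermL.
apply: le_trans (exchange_apart (y := y) _ _ _) => //; last first.
  by move=> z zx zy; rewrite tpermD 1?eq_sym //; apply: ab.
rewrite le_eqVlt; apply/orP; left; apply/eqP; apply: eq_big => [p|p _].
  have -> : relp (tw p) = (tperm x y * relp p)%g by rewrite /relp /= mulgA.
  by rewrite negbK porbit_sym porbit_mul_tperm // porbit_sym.
congr (_ * _); rewrite /diag_prod (reindex_inj (@perm_inj _ (tperm x y))) /=.
by apply: eq_bigr => z _; rewrite permM tpermK.
Qed.

End Permanents.

(** * Subadditivity of squared differences over commuting involutions *)

Section Hypercube.
Variables (R : realFieldType).

Lemma commuting_involutions (X : finType) (om g : X -> R) (A B : X -> X) :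
  (forall x, 0 <= om x) -> involutive A -> involutive B ->
  (forall x, A (B x) = B (A x)) ->
  (forall x, om (A x) = om x) -> (forall x, om (B x) = om x) ->
  \sum_x om x * (g x - g (A (B x))) ^+ 2 <=
  \sum_x om x * (g x - g (A x)) ^+ 2 + \sum_x om x * (g x - g (B x)) ^+ 2.
Proof.
move=> om0 AK BK AB omA omB.
set L := \sum_x _; set SA := \sum_x _; set SB := \sum_x _.
have L' : L = \sum_x om x * (g (A x) - g (B x)) ^+ 2.
  rewrite /L (reindex_inj (inv_inj AK)); apply: eq_bigr => x _.
  by rewrite omA -AB AK.
have SA' : SA = \sum_x om x * (g (B x) - g (A (B x))) ^+ 2.
  by rewrite /SA (reindex_inj (inv_inj BK)); apply: eq_bigr => x _; rewrite omB.
have SB' : SB = \sum_x om x * (g (A x) - g (A (B x))) ^+ 2.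
  rewrite /SB (reindex_inj (inv_inj AK)); apply: eq_bigr => x _.
  by rewrite omA AB.
have : L + L <= (SA + SA) + (SB + SB); last by lra.
rewrite {2}L' {2}SA' {2}SB' -!big_split /=; apply: ler_sum => x _.
rewrite -!mulrDr ler_wpM2l //.
(* The squared sides of the quadrilateral [x], [A x], [A (B x)], [B x] exceed the squared diagonals
   by exactly this square. *)
have := sqr_ge0 (g x + g (A (B x)) - g (A x) - g (B x)); nra.
Qed.

Variable V : finType.
Implicit Types (p : {perm V} * {perm V}) (O : {set V}).

(** All subsets of [V] are adjoined to [Q] one at a time, each costing at most the energy of [cswap
    [set O]], which is the identity on pairs of which [O] is not a cycle. In the end [Q] is
    everything and [cswapT] exchanges the two permutations. *)
Lemma sum_sqr_exchange_le (lam : V -> V -> R) (f : {perm V} -> R) :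
  (forall x y, 0 <= lam x y) ->
  \sum_p diag_prod lam p.1 * diag_prod lam p.2 * (f p.1 - f p.2) ^+ 2 <=
  \sum_p diag_prod lam p.1 * diag_prod lam p.2 *
    \sum_(O in porbits (relp p)) (f p.1 - f (swap O p).1) ^+ 2.
Proof.
move=> lam0; set om := fun p => diag_prod lam p.1 * diag_prod lam p.2.
have om0 p : 0 <= om p by rewrite mulr_ge0 ?diag_prod_ge0.
have omc Q p : om (cswap Q p) = om p.
  by rewrite /om diag_prod_swap_id //; exact: stable_cycles.
pose D Q := \sum_p om p * (f p.1 - f (cswap Q p).1) ^+ 2.
have DU (Q Q' : {set {set V}}) : [disjoint Q & Q'] -> D (Q :|: Q') <= D Q + D Q'.
  move=> dis; have dis' : [disjoint Q' & Q] by rewrite disjoint_sym.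
  rewrite /D; under eq_bigr => p _ do rewrite -cswapU //.
  apply: (@commuting_involutions _ om (fun p => f p.1)) => //; try exact: cswapK.
  by move=> p; rewrite !cswapU // setUC.
have Ds (s : seq {set V}) : uniq s -> D [set O in s] <= \sum_(O <- s) D [set O].
  elim: s => [_|O s IH /= /andP[Os us]].
    rewrite big_nil /D big1 // => p _; rewrite /cswap /cycles.
    have -> : [set O in [::]] = set0 :> {set {set V}} by apply/setP => O; rewrite !inE.
    rewrite set0I /cover big_set0.
    have n0 : stable set0 p by apply/stableP => x; rewrite !inE.
    suff -> : (swap set0 p).1 = p.1 by rewrite subrr expr0n /= mulr0.
    by apply/permP => x; rewrite swapE1 // inE.
  rewrite big_cons set_cons; apply: le_trans (lerD (lexx _) (IH us)).
  by apply: DU; rewrite disjoints1 inE.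
have := Ds (enum {: {set V}}) (enum_uniq _).
have -> : [set O in enum {: {set V}}] = setT by apply/setP => O; rewrite !inE mem_enum.
rewrite /D; under eq_bigr => p _ do rewrite cswapT.
move/le_trans; apply.
rewrite big_enum /= exchange_big /=; apply: ler_sum => p _.
rewrite -mulr_sumr ler_wpM2l // [X in _ <= X]big_mkcond /=; apply: ler_sum => O _.
by rewrite -[mix (cycles _ _) _ _]/(cswap [set O] p).1 cswap1; case: ifP => _ //; rewrite subrr expr0n.
Qed.

End Hypercube.

(** * Minors, column replacement and their exchange inequality *)

Section Minors.
Variables (R : realFieldType) (V : finType).
Implicit Types (lam : V -> V -> R) (s t : {perm V}) (u v b x y z : V).

Definition hole_prod lam s u : R := \prod_(x | x != u) lam x (s x).

Definition minor lam u v : R := \sum_(s : {perm V} | s u == v) hole_prod lam s u.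

(** The permanent of [lam] with column [v] replaced by column [b], given by its expansion along the
    replaced column. *)
Definition col_replaced lam v b : R := \sum_z lam z b * minor lam z v.

Lemma diag_prodE lam s u : diag_prod lam s = lam u (s u) * hole_prod lam s u.
Proof. by rewrite /diag_prod (bigD1 u). Qed.

Lemma permanent_tr lam : permanent (fun y x => lam x y) = permanent lam.
Proof.
rewrite /permanent (reindex_inj invg_inj) /=; apply: eq_bigr => s _.
rewrite /diag_prod (reindex_inj (@perm_inj _ s)) /=.
by apply: eq_bigr => x _; rewrite permK.
Qed.

Lemma permanent_set_row lam v (r : V -> R) :
  permanent (set_row (fun y x => lam x y) v r) = \sum_z r z * minor lam z v.
Proof.
rewrite /permanent (partition_big (fun s : {perm V} => s v) predT) //=.
apply: eq_bigr => z _; rewrite /minor mulr_sumr (reindex_inj invg_inj) /=.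
apply: eq_big => [s|s /eqP sz].
  by apply/eqP/eqP => [<-|<-]; rewrite ?permK ?permKV.
rewrite /diag_prod (bigD1 v) //= /set_row eqxx sz; congr (_ * _).
rewrite (reindex_inj (@perm_inj _ s)) /=; apply: eq_big => x.
  by rewrite -sz -(inj_eq (@perm_inj _ s^-1%g)) permK.
by move=> /negPf ->; rewrite permK.
Qed.

Lemma permanent_tperm (a : V -> V -> R) x y :
  permanent (fun z => a (tperm x y z)) = permanent a.
Proof.
rewrite /permanent (reindex_inj (mulgI (tperm x y))) /=; apply: eq_bigr => s _.
rewrite /diag_prod (reindex_inj (@perm_inj _ (tperm x y))) /=.
by apply: eq_bigr => z _; rewrite permM tpermK.
Qed.

Lemma col_replaced_id lam v : col_replaced lam v v = permanent lam.
Proof.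
rewrite -permanent_tr; rewrite /col_replaced -permanent_set_row.
by apply: eq_permanent => z x; rewrite /set_row; case: eqP => // ->.
Qed.

Variable lam : V -> V -> R.
Hypothesis lam_gt0 : forall x y, 0 < lam x y.

Lemma hole_prod_gt0 s u : 0 < hole_prod lam s u.
Proof. exact: prodr_gt0. Qed.

Lemma diag_prod_gt0 s : 0 < diag_prod lam s.
Proof. exact: prodr_gt0. Qed.

Lemma permanent_gt0 : 0 < permanent lam.
Proof.
rewrite /permanent (bigD1 1%g) //= ltr_wpDr ?diag_prod_gt0 //.
by apply: sumr_ge0 => s _; rewrite ltW ?diag_prod_gt0.
Qed.

Lemma minor_gt0 u v : 0 < minor lam u v.
Proof.
rewrite /minor (bigD1 (tperm u v)) ?tpermL //= ltr_wpDr ?hole_prod_gt0 //.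
by apply: sumr_ge0 => s _; rewrite ltW ?hole_prod_gt0.
Qed.

Lemma col_replaced_gt0 v b : 0 < col_replaced lam v b.
Proof.
rewrite /col_replaced (bigD1 v) //= ltr_wpDr ?mulr_gt0 ?minor_gt0 //.
by apply: sumr_ge0 => z _; rewrite mulr_ge0 ?ltW ?minor_gt0.
Qed.

(* With one column v doubled into b and the hole (u, b) in the other factor,
   this is the exchange inequality for the rows of the transposed matrix. *)
Lemma col_replaced_minor u v b :
  col_replaced lam v b * minor lam u b <= 2 * permanent lam * minor lam u v.
Proof.
have [<-|vb] := eqVneq v b.
  have P0 := permanent_gt0; have m0 := minor_gt0 u v.
  by rewrite col_replaced_id; nra.
(* With a row replaced by the unit vector at [u], a minor becomes a permanent, so [exchange] applies
   to both factors. *)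
pose A y x := lam x y; pose e z : R := (z == u)%:R.
have minorE w : minor lam u w = permanent (set_row A w e).
  rewrite permanent_set_row (bigD1 u) //= /e eqxx mul1r big1 ?addr0 // => z /negPf->.
  by rewrite mul0r.
have A0 y x : 0 <= A y x by exact: ltW (lam_gt0 x y).
have s0 w (r : V -> R) : (forall x, 0 <= r x) -> forall x y, 0 <= set_row A w r x y.
  by move=> r0 x y; rewrite /set_row; case: ifP.
have -> : col_replaced lam v b = permanent (set_row A v (A b)).
  by rewrite permanent_set_row.
rewrite (minorE b).
apply: le_trans (exchange vb _ _ _) _.
- exact: s0.
- by apply: s0 => x; rewrite ler0n.
- by move=> z /negPf zv /negPf zb x; rewrite /set_row zv zb.
have PA : permanent lam = permanent A by rewrite permanent_tr.
have vb' := negPf vb; have bv' : b == v = false by rewrite eq_sym.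
(* Up to interchanging rows [v] and [b], the four matrices are [A], [set_row A v e],
   [set_row A v e], [A] in this order. Both products are therefore the same, whence the constant
   2. *)
rewrite (@eq_permanent _ _ _ A); last first.
  by move=> z x; rewrite /set_row vb'; case: eqP => // ->.
rewrite (@eq_permanent _ _ (set_row (set_row A b e) v _)
  (fun z => set_row A v e (tperm v b z))); last first.
  move=> z x; rewrite /set_row eqxx.
  by case: tpermP => [->|->|/eqP/negPf-> /eqP/negPf->]; rewrite ?eqxx ?bv'.
rewrite (@eq_permanent _ _ (set_row (set_row A v (A b)) v _) (set_row A v e)); last first.
  by move=> z x; rewrite /set_row eqxx; case: eqP => //.
rewrite (@eq_permanent _ _ (set_row _ v (set_row A v (A b) v))
  (fun z => A (tperm v b z))); last first.
  move=> z x; rewrite /set_row eqxx.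
  case: tpermP => [->|->|/eqP/negPf-> /eqP/negPf->]; rewrite ?eqxx ?bv' ?vb' //.
rewrite !permanent_tperm -PA -minorE; lra.
Qed.

(** This is [col_replaced_minor] summed over [u] with weights [lam u v]: on the right the minors add
    up to the permanent. *)
Lemma col_replaced_log_concave v b :
  col_replaced lam v b * col_replaced lam b v <= 2 * permanent lam ^+ 2.
Proof.
rewrite {2}/col_replaced mulr_sumr expr2.
have -> : 2 * (permanent lam * permanent lam) = 2 * permanent lam * col_replaced lam v v.
  by rewrite col_replaced_id mulrA.
rewrite {2}/col_replaced [X in _ <= X]mulr_sumr; apply: ler_sum => u _.
rewrite mulrCA [X in _ <= X]mulrCA.
by apply: ler_wpM2l; [exact: ltW | exact: col_replaced_minor].
Qed.

End Minors.

(** * Sliding paths *)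

Section OrbitSums.
Variable R : realFieldType.

Lemma sqr_sum_le (n : nat) (d : nat -> R) :
  (\sum_(j < n) d j) ^+ 2 <= n%:R * \sum_(j < n) d j ^+ 2.
Proof.
elim: n => [|n IH]; first by rewrite !big_ord0 mul0r expr0n.
rewrite !big_ord_recr /=; set S := \sum_(j < n) d j in IH *.
set Q := \sum_(j < n) _ in IH *; set e := d n.
have : 0 <= \sum_(j < n) (d j - e) ^+ 2 by apply: sumr_ge0 => j _; exact: sqr_ge0.
have -> : \sum_(j < n) (d j - e) ^+ 2 = Q - 2 * e * S + n%:R * e ^+ 2.
  under eq_bigr => j _ do rewrite sqrrB.
  rewrite big_split /= sumrB sumr_const card_ord; congr (_ - _ + _); last by rewrite mulr_natl.
  by rewrite /S mulr_sumr; apply: eq_bigr => j _; rewrite mulr2n; ring.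
rewrite mulrSr; move: IH; nra.
Qed.

Lemma sqr_telescope_le (n : nat) (a : nat -> R) :
  (a 0%N - a n) ^+ 2 <= n%:R * \sum_(j < n) (a j - a j.+1) ^+ 2.
Proof.
suff -> : a 0%N - a n = \sum_(j < n) (a j - a j.+1) by exact: (sqr_sum_le n (fun j => a j - a j.+1)).
elim: n => [|n IH]; first by rewrite big_ord0 subrr.
by rewrite big_ord_recr /= -IH; ring.
Qed.

(** The map sending [(x, j)] to [iter j phi x] is injective on the index set: two coinciding points
    would, by injectivity of [phi], make one trajectory meet [S] again too early. The bound [M]
    provides a finite index type. *)
Lemma sum_iter_le (T : finType) (phi : T -> T) (th G : T -> R) (S : pred T)
    (len : T -> nat) (M : nat) :
  injective phi -> (forall x, th (phi x) = th x) ->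
  (forall x, 0 <= th x * G x) -> (forall x, (len x <= M)%N) ->
  (forall x j, S x -> (0 < j < len x)%N -> ~~ S (iter j phi x)) ->
  \sum_(x | S x) th x * \sum_(j < len x) G (iter j phi x) <= \sum_x th x * G x.
Proof.
move=> phi_inj thE H0 lenM Sfirst.
have th_iter j x : th (iter j phi x) = th x by elim: j => //= j <-; exact: thE.
have iter_inj j : injective (iter j phi).
  by elim: j => [|j IH] x y //= /phi_inj /IH.
pose H x := th x * G x; pose h (q : T * 'I_M) := iter q.2 phi q.1.
pose A := [set q : T * 'I_M | S q.1 && (q.2 < len q.1)%N].
have -> : \sum_(x | S x) th x * \sum_(j < len x) G (iter j phi x) =
    \sum_(q in A) H (h q).
  under [RHS]eq_bigl => q do rewrite inE.
  rewrite -(pair_big_dep S (fun x (j : 'I_M) => (j < len x)%N)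
    (fun x j => H (h (x, j)))) /=.
  apply: eq_bigr => x _; rewrite mulr_sumr (big_ord_widen _ (fun j => th x * G (iter j phi x)) (lenM x)).
  by apply: eq_bigr => j _; rewrite /H th_iter.
have key x y (i j : nat) : (i <= j)%N -> S x -> S y -> (j < len y)%N ->
    iter i phi x = iter j phi y -> i = j.
  move=> ij Sx Sy jl; rewrite -(subnKC ij) iterD => /iter_inj E.
  apply/eqP; move: ij; rewrite leq_eqVlt => /orP[/eqP-> //|ij]; first by rewrite subnn addn0.
  have := Sfirst y (j - i)%N Sy; rewrite subn_gt0 ij -E Sx.
  by move/(_ _)/negP; case; rewrite ?(leq_ltn_trans (leq_subr _ _)).
have h_inj : {in A &, injective h}.
  move=> [x i] [y j]; rewrite !inE /h /= => /andP[Sx xi] /andP[Sy yj] E.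
  have ij : i = j :> nat.
    by case: (leqP i j) => [le|/ltnW le]; [exact: key E | symmetry; exact: key (esym E)].
  by move: E; rewrite ij => /iter_inj ->; congr pair; apply: val_inj.
rewrite -(big_imset H h_inj) /= big_mkcond /=; apply: ler_sum => x _.
by case: ifP => // _; exact: H0.
Qed.

End OrbitSums.

Section SlidingPath.
Variables (R : realFieldType) (V : finType) (lam : V -> V -> R).
Hypothesis lam_gt0 : forall x y, 0 < lam x y.
Variables (fP : {perm V} -> R) (fN : {perm V} -> V -> R).
Variable u : V.
Implicit Types (s t : {perm V}) (p : {perm V} * {perm V}) (b x y z : V).

(** The first matching has its hole at [z], the second at [u], and [(z, t u)] is a separate edge. A
    step puts this edge into the first matching, moves the edge at [t u] thereby released into the
    second, and takes out the edge [(x, t x)] as the next separate one. *)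
Definition slide_step (q : {perm V} * {perm V} * V) : {perm V} * {perm V} * V :=
  let x := q.1.1^-1%g (q.1.2 u) in
  ((tperm q.2 x * q.1.1)%g, (tperm x u * q.1.2)%g, x).

(** When [b] is the right hole itself, the pivot is [z] and the move closes the matching; otherwise
    it is a left slide. *)
Definition slide_sqr s z b : R :=
  let x := s^-1%g b in
  if x == z then (fN s z - fP s) ^+ 2 else (fN s z - fN (tperm z x * s)%g x) ^+ 2.

Lemma slide_step_inj : injective slide_step.
Proof.
pose back (q : {perm V} * {perm V} * V) :=
  let z := q.1.1^-1%g (q.1.2 q.2) in
  ((tperm z q.2 * q.1.1)%g, (tperm q.2 u * q.1.2)%g, z).
apply: (@can_inj _ _ _ back) => -[[s t] z]; rewrite /slide_step /back /=.
set x := s^-1%g (t u).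
have -> : (tperm z x * s)^-1%g ((tperm x u * t)%g x) = z.
  by rewrite permM tpermL invMg tpermV permM -/x tpermR.
by rewrite !mulgA !tperm2 !mul1g.
Qed.

Lemma hole_prod_slide s z x :
  hole_prod lam (tperm z x * s)%g x * lam x (s x) = hole_prod lam s z * lam z (s x).
Proof.
have [->|zx] := eqVneq z x; first by rewrite tperm1 mul1g.
rewrite /hole_prod (bigD1 z) //= [X in _ = X * _](bigD1 x) 1?eq_sym //=.
rewrite permM tpermL.
suff -> : \prod_(i | (i != x) && (i != z)) lam i ((tperm z x * s)%g i) =
  \prod_(i | (i != z) && (i != x)) lam i (s i) by ring.
apply: eq_big => i; first by rewrite andbC.
by move=> /andP[ix iz]; rewrite permM tpermD // eq_sym.
Qed.

Definition slide_weight (q : {perm V} * {perm V} * V) : R :=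
  hole_prod lam q.1.1 q.2 * (hole_prod lam q.1.2 u * lam q.2 (q.1.2 u)).

(** A step only redistributes edges: the multiset formed by both punctured matchings and the
    separate edge is conserved. *)
Lemma slide_weight_step q : slide_weight (slide_step q) = slide_weight q.
Proof.
case: q => -[s t] z; rewrite /slide_weight /slide_step /=; set x := s^-1%g (t u).
have sx : s x = t u by rewrite /x permKV.
have E1 := hole_prod_slide s z x; have E2 := hole_prod_slide t x u.
have D1 := diag_prodE lam t u; have D2 := diag_prodE lam t x.
rewrite permM tpermR; rewrite sx in E1.
have E3 : hole_prod lam (tperm x u * t)%g u * lam x (t x) = hole_prod lam t u * lam x (t u).
  apply: (mulIf (lt0r_neq0 (lam_gt0 u (t u)))).
  rewrite mulrAC E2 mulrAC [hole_prod lam t x * _]mulrC -D2 D1; ring.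
by rewrite E3 mulrCA [X in _ = X]mulrCA E1.
Qed.

Section FromStart.
Variable p : {perm V} * {perm V}.
Local Notation r := (relp p).
Local Notation st j := (iter j slide_step (p, u)).
Local Notation len := #|porbit r u|.

Lemma iter_relp_neq (i j : nat) : (i < len)%N -> (j < len)%N -> i != j ->
  iter i r u != iter j r u.
Proof.
move=> il jl; apply: contra_neq => E; apply/eqP.
have := uniq_traject_porbit r u.
move/(nth_uniq u); rewrite size_traject => /(_ i j il jl) <-.
by rewrite !nth_traject // E.
Qed.

Lemma iter_slide (j : nat) : (j < len)%N ->
  [/\ (st j).2 = iter j r u,
      forall i, (i < j)%N -> (st j).1.1 (iter i r u) = p.2 (iter i r u),
      (st j).1.1 (iter j r u) = p.1 u,
      (st j).1.2 u = p.2 (iter j r u) &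
      forall y, (forall i, (i <= j)%N -> y != iter i r u) ->
        (st j).1.1 y = p.1 y /\ (st j).1.2 y = p.2 y].
Proof.
elim: j => [|j IH] jl; first by split.
have {IH} [Ez Elt Ej Eu Eo] := IH (ltnW jl).
have new i : (i <= j)%N -> iter j.+1 r u != iter i r u.
  move=> ij; apply: iter_relp_neq => //; first exact: leq_ltn_trans (ltnW jl).
  by rewrite gtn_eqF.
have [Es Et] := Eo _ new.
have Ex : (st j).1.1^-1%g ((st j).1.2 u) = iter j.+1 r u.
  by rewrite Eu -relpK -Es permK.
have E : st j.+1 = ((tperm (iter j r u) (iter j.+1 r u) * (st j).1.1)%g,
                    (tperm (iter j.+1 r u) u * (st j).1.2)%g, iter j.+1 r u).
  by rewrite [LHS]iterS /slide_step Ex Ez.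
rewrite E /=; split => //.
- move=> i; rewrite ltnS leq_eqVlt => /orP[/eqP->|ij].
    by rewrite permM tpermL Es relpK.
  have il : (i < len)%N by apply: ltn_trans ij _; exact: ltnW.
  rewrite permM tpermD ?Elt //.
    by rewrite eq_sym iter_relp_neq ?ltn_eqF // ltnW.
  by apply: new; exact: ltnW.
- by rewrite permM tpermR.
- by rewrite permM tpermR.
- move=> y yn.
  have y0 : u != y by rewrite eq_sym (yn 0%N).
  have yj : iter j r u != y by rewrite eq_sym yn.
  have yj1 : r (iter j r u) != y by rewrite eq_sym (yn j.+1).
  rewrite !permM !tpermD -?relpE //; apply: Eo => i ij; apply: yn; exact: leqW.
Qed.

Lemma iter_slide_pivot (j : nat) : (j.+1 < len)%N ->
  (st j).1.1^-1%g ((st j).1.2 u) = (st j.+1).2 /\ (st j.+1).2 != (st j).2.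
Proof.
move=> jl; have [Ez _ _ _ _] := iter_slide (ltnW jl).
have [Ez' _ _ _ _] := iter_slide jl; split=> //.
by rewrite Ez Ez' iter_relp_neq // ?gtn_eqF // ltnW.
Qed.

(** At the last vertex of the cycle the next right vertex is [p.1 u], the right hole, so the move
    from there is the closing one. *)
Lemma iter_slide_last : let j := len.-1 in
  (st j).1.1^-1%g ((st j).1.2 u) = (st j).2 /\ (st j).1.1 = (swap_at u p).1.
Proof.
have l0 : (0 < len)%N by rewrite lt0n card_porbit_neq0.
move=> j; have jl : (j < len)%N by rewrite prednK.
have [Ez Elt Ej Eu Eo] := iter_slide jl.
have back : p.2 (iter j r u) = p.1 u.
  by rewrite -relpK -iterS prednK // iter_porbit.
split; first by rewrite Eu back -Ej permK Ez.
apply/permP => y; rewrite swapE1; last exact: stable_porbit.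
rewrite porbit_traject; case: ifP => [/trajectP[i il ->]|yn].
  have [->|ij] := eqVneq i j; first by rewrite Ej back.
  by rewrite Elt // ltn_neqAle ij -ltnS prednK.
have [] // := Eo y; move=> i ij; apply: contraFneq yn => ->.
by apply/trajectP; exists i => //; exact: leq_ltn_trans jl.
Qed.

Lemma slide_path_sqr :
  (fN p.1 u - fP (swap_at u p).1) ^+ 2 <=
  len%:R * \sum_(j < len) slide_sqr (st j).1.1 (st j).2 ((st j).1.2 u).
Proof.
have l0 : (0 < len)%N by rewrite lt0n card_porbit_neq0.
(* The path has [len] moves: [len - 1] slides, then the closing move into the swapped matching. *)
pose a j := if (j < len)%N then fN (st j).1.1 (st j).2 else fP (swap_at u p).1.
have := sqr_telescope_le len a; rewrite {1 2}/a l0 ltnn /= => /le_trans; apply.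
apply: ler_wpM2l; first by rewrite ler0n.
rewrite le_eqVlt; apply/orP; left; apply/eqP; apply: eq_bigr => j _.
rewrite /a ltn_ord /slide_sqr; have [jl|jl] := ltnP j.+1 len.
  have [Ex /negPf neq] := iter_slide_pivot jl.
  have E : (st j.+1).1.1 = (tperm (st j).2 (st j.+1).2 * (st j).1.1)%g by [].
  by rewrite Ex neq E.
have jE : j = len.-1 :> nat by apply/eqP; rewrite -eqSS prednK // eqn_leq ltn_ord.
have [Ex Es] := iter_slide_last; rewrite jE Ex eqxx.
by rewrite Es.
Qed.

End FromStart.

(** Slides fix the right hole, so [k] times the slide weight is constant along a path, and a path
    leaves [z = u] without returning. Hence [sum_iter_le] bounds the sum over paths by a sum over
    all triples; grouping [t] by [b = t u] produces [minor lam u b]. *)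
Lemma sum_slide_paths (k : V -> R) : (forall v, 0 <= k v) ->
  \sum_(p : {perm V} * {perm V}) k (p.1 u) * (hole_prod lam p.1 u * diag_prod lam p.2) *
    (\sum_(j < #|porbit (relp p) u|)
       let q := iter j slide_step (p, u) in slide_sqr q.1.1 q.2 (q.1.2 u)) <=
  \sum_(s : {perm V}) \sum_z k (s z) * (hole_prod lam s z *
    \sum_b lam z b * minor lam u b * slide_sqr s z b).
Proof.
move=> k0.
pose T := ({perm V} * {perm V} * V)%type.
pose th (q : T) := k (q.1.1 q.2) * slide_weight q.
pose G (q : T) := slide_sqr q.1.1 q.2 (q.1.2 u).
pose S (q : T) := q.2 == u.
have G0 q : 0 <= G q by rewrite /G /slide_sqr; case: ifP => _; exact: sqr_ge0.
have thE q : th (slide_step q) = th q.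
  by rewrite /th slide_weight_step /slide_step /= permM tpermR.
have th0 q : 0 <= th q.
  by rewrite mulr_ge0 ?mulr_ge0 // ltW ?hole_prod_gt0.
have len_le (q : T) : (#|porbit (relp q.1) u| <= #|V|)%N by exact: max_card.
have first (q : T) j : S q -> (0 < j < #|porbit (relp q.1) u|)%N -> ~~ S (iter j slide_step q).
  case: q => p z /eqP /= -> /andP[j0 jl]; rewrite /S.
  have [-> _ _ _ _] := iter_slide jl.
  by apply: (@iter_relp_neq p j 0%N) => //; rewrite ?lt0n_neq0 ?gtn_eqF // (ltn_trans j0).
have := @sum_iter_le _ _ slide_step th G S _ _ slide_step_inj thE
  (fun q => mulr_ge0 (th0 q) (G0 q)) len_le first.
have -> : \sum_(q | S q) th q * \sum_(j < #|porbit (relp q.1) u|) G (iter j slide_step q) =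
  \sum_(p : {perm V} * {perm V}) k (p.1 u) * (hole_prod lam p.1 u * diag_prod lam p.2) *
    (\sum_(j < #|porbit (relp p) u|) G (iter j slide_step (p, u))).
  transitivity (\sum_p \sum_(z | z == u) th (p, z) *
    \sum_(j < #|porbit (relp p) u|) G (iter j slide_step (p, z))).
    by rewrite pair_big /=; apply: eq_big => -[].
  apply: eq_bigr => p _; rewrite big_pred1_eq; congr (_ * _).
  by rewrite /th /slide_weight /= (diag_prodE lam p.2 u); ring.
move/le_trans; apply.
rewrite le_eqVlt; apply/orP; left; apply/eqP.
transitivity (\sum_s \sum_t \sum_z th (s, t, z) * G (s, t, z)).
  by rewrite pair_bigA pair_bigA /=; apply: eq_bigr => -[[]].
apply: eq_bigr => s _; rewrite exchange_big /=; apply: eq_bigr => z _.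
rewrite mulr_sumr mulr_sumr (partition_big (fun t : {perm V} => t u) predT) //=.
apply: eq_bigr => b _; rewrite /minor mulr_sumr mulr_suml !mulr_sumr.
apply: eq_bigr => t /eqP tb; rewrite /th /G /slide_weight /= tb; ring.
Qed.

End SlidingPath.

(** * Comparison with left slides *)

Section Comparison.
Variables (R : realType) (V : finType) (lam w : V -> V -> R) (c : R).
Hypothesis lam_gt0 : forall x y, 0 < lam x y.
Hypothesis w_gt0 : forall x y, 0 < w x y.
Hypothesis c_ge1 : 1 <= c.
Local Notation P := (permanent lam).
Hypothesis w_lower : forall u v, P <= c * (w u v * minor lam u v).
Hypothesis w_upper : forall u v, w u v * minor lam u v <= c * P.
Variables (fP : {perm V} -> R) (fN : {perm V} -> V -> R).
Implicit Types (s t : {perm V}) (p : {perm V} * {perm V}) (b u v x y z : V).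

Local Notation n := (#|V|%:R : R).
Local Notation T := (col_replaced lam).
Local Notation L := (Lw lam w).
Let P_gt0 : 0 < P := permanent_gt0 lam_gt0.
Let c_gt0 : 0 < c := lt_le_trans ltr01 c_ge1.

Definition open_energy : R :=
  \sum_s \sum_u diag_prod lam s * (fP s - fN s u) ^+ 2.

Definition left_energy : R :=
  \sum_(s : {perm V}) \sum_z \sum_(x | x != z)
    hole_prod lam s z * (lam z (s x) * L (s z) (s x)) *
    (fN s z - fN (tperm z x * s)%g x) ^+ 2.

Lemma Lw_ge0 v b : 0 <= L v b.
Proof.
rewrite /Lw; case: ifP => // _; rewrite invr_ge0; apply: sumr_ge0 => z _.
by rewrite divr_ge0 // ltW.
Qed.

Lemma open_energy_ge0 : 0 <= open_energy.
Proof.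
apply: sumr_ge0 => s _; apply: sumr_ge0 => u _.
by apply: mulr_ge0; [exact: ltW (diag_prod_gt0 lam_gt0 s) | exact: sqr_ge0].
Qed.

Lemma left_energy_ge0 : 0 <= left_energy.
Proof.
apply: sumr_ge0 => s _; apply: sumr_ge0 => u _; apply: sumr_ge0 => x _.
apply: mulr_ge0; last exact: sqr_ge0.
apply: mulr_ge0; first exact: ltW (hole_prod_gt0 lam_gt0 s u).
by rewrite mulr_ge0 ?Lw_ge0 // ltW.
Qed.

(** The inverse of [L v b] is the sum of [lam z b / w z v]. Roughness replaces [1 / w z v] by
    [minor lam z v / P] up to a factor [c], which gives [T v b / P]. *)
Lemma Lw_bounds v b : b != v -> P <= c * (L v b * T v b) /\ L v b * T v b <= c * P.
Proof.
move=> /negPf bv; rewrite /Lw bv; set S := \sum_z _.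
have S_gt0 : 0 < S.
  rewrite /S (bigD1 v) //= ltr_wpDr ?divr_gt0 //.
  by apply: sumr_ge0 => z _; rewrite divr_ge0 // ltW.
have PS : P * S <= c * T v b.
  rewrite [X in X <= _]mulr_sumr [X in _ <= X]mulr_sumr; apply: ler_sum => z _.
  rewrite mulrCA [X in _ <= X]mulrCA; apply: ler_wpM2l; first exact: ltW.
  rewrite ler_pdivrMr // -mulrA; apply: le_trans (w_lower z v) _.
  by rewrite [w z v * _]mulrC.
have TS : T v b <= c * P * S.
  rewrite [X in _ <= X]mulr_sumr; apply: ler_sum => z _.
  rewrite mulrCA; apply: ler_wpM2l; first exact: ltW.
  by rewrite ler_pdivlMr // [_ * w _ _]mulrC.
split; first by rewrite mulrCA [X in _ <= X]mulrC ler_pdivlMr.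
by rewrite mulrC ler_pdivrMr.
Qed.

Lemma slide_sqr_sum_le (K : V -> V -> R) (C1 C2 : R) :
  (forall v b, b != v -> K v b <= C1 * L v b) -> (forall v, K v v <= C2) ->
  \sum_(s : {perm V}) \sum_z hole_prod lam s z *
    (\sum_b lam z b * K (s z) b * slide_sqr fP fN s z b) <=
  C1 * left_energy + C2 * open_energy.
Proof.
move=> K1 K2; rewrite /left_energy /open_energy !mulr_sumr -big_split /=.
apply: ler_sum => s _; rewrite !mulr_sumr -big_split /=; apply: ler_sum => z _.
rewrite (reindex_inj (@perm_inj _ s)) /= (bigD1 z) //= addrC mulrDr.
have h0 := ltW (hole_prod_gt0 lam_gt0 s z); apply: lerD; last first.
  rewrite /slide_sqr permK eqxx (diag_prodE lam s z).
  have l0 := ltW (lam_gt0 z (s z)).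
  rewrite -[(fP s - _) ^+ 2]sqrrN opprB; set q := (fN s z - _) ^+ 2.
  have -> : hole_prod lam s z * (lam z (s z) * K (s z) (s z) * q) =
    K (s z) (s z) * (lam z (s z) * hole_prod lam s z * q) by ring.
  apply: ler_wpM2r => //; exact: mulr_ge0 (mulr_ge0 l0 h0) (sqr_ge0 _).
rewrite !mulr_sumr; apply: ler_sum => x xz; rewrite /slide_sqr permK (negPf xz).
rewrite mulrA [X in _ <= X]mulrA; apply: ler_wpM2r; first exact: sqr_ge0.
have -> : C1 * (hole_prod lam s z * (lam z (s x) * L (s z) (s x))) =
  hole_prod lam s z * (lam z (s x) * (C1 * L (s z) (s x))) by ring.
apply: ler_wpM2l => //; apply: ler_wpM2l; first exact: ltW.
by apply: K1; rewrite (inj_eq (@perm_inj _ s)).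
Qed.

Definition path_sqr u p : R :=
  \sum_(j < #|porbit (relp p) u|)
    let q := iter j (slide_step u) (p, u) in slide_sqr fP fN q.1.1 q.2 (q.1.2 u).

Lemma path_sqr_ge0 u p : 0 <= path_sqr u p.
Proof.
by apply: sumr_ge0 => j _; rewrite /slide_sqr; case: ifP => _; exact: sqr_ge0.
Qed.

(** A congestion criterion. With starting weights [k], the sum of [k u v * minor lam u b] is the
    load at right hole [v] and right vertex [b]; it is compared with the slide rate for [b != v] and
    with a constant for the closing move. *)
Lemma path_sqr_sum_le (k : V -> V -> R) (C1 C2 : R) :
  (forall u v, 0 <= k u v) ->
  (forall v b, b != v -> \sum_u k u v * minor lam u b <= C1 * L v b) ->
  (forall v, \sum_u k u v * minor lam u v <= C2) ->
  \sum_u \sum_(p : {perm V} * {perm V}) k u (p.1 u) * (hole_prod lam p.1 u * diag_prod lam p.2) *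
    path_sqr u p <=
  C1 * left_energy + C2 * open_energy.
Proof.
move=> k0 k1 k2; apply: le_trans (slide_sqr_sum_le k1 k2).
apply: (@le_trans _ _ (\sum_u \sum_(s : {perm V}) \sum_z k u (s z) *
  (hole_prod lam s z * \sum_b lam z b * minor lam u b * slide_sqr fP fN s z b))).
  by apply: ler_sum => u _; apply: (sum_slide_paths lam_gt0 fP fN u (k0 u)).
rewrite le_eqVlt; apply/orP; left; apply/eqP.
rewrite exchange_big; apply: eq_bigr => s _ /=.
rewrite exchange_big; apply: eq_bigr => z _ /=.
under eq_bigr => u _ do rewrite mulrCA mulr_sumr.
rewrite -mulr_sumr exchange_big /=; congr (_ * _); apply: eq_bigr => b _.
by rewrite mulr_sumr mulr_suml; apply: eq_bigr => u _; ring.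
Qed.

Lemma sqrD_le (a b d e : R) : (a - b) ^+ 2 <= e -> (a - d) ^+ 2 <= 2 * e + 2 * (b - d) ^+ 2.
Proof. have := sqr_ge0 (a - b - (b - d)); nra. Qed.

Lemma perfect_pairs_le :
  \sum_(p : {perm V} * {perm V}) diag_prod lam p.1 * diag_prod lam p.2 * (fP p.1 - fP p.2) ^+ 2 <=
  P * (4 * open_energy + 4 * c * left_energy).
Proof.
apply: le_trans (sum_sqr_exchange_le fP (fun x y => ltW (lam_gt0 x y))) _.
have dd0 p : 0 <= diag_prod lam p.1 * diag_prod lam p.2.
  by rewrite mulr_ge0 // ltW ?diag_prod_gt0.
have path : \sum_u \sum_(p : {perm V} * {perm V}) lam u (p.1 u) * (hole_prod lam p.1 u * diag_prod lam p.2) *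
    path_sqr u p <= 2 * c * P * left_energy + P * open_energy.
  apply: path_sqr_sum_le => [u v|v b bv|v]; first exact: ltW.
  (* The load is [T b v]. Multiplying the lower bound for [L v b * T v b] by [T b v], then applying
     log-concavity and cancelling [P], gives [2 * c * P * L v b]. *)
  - rewrite -/(T b v); have [LT _] := Lw_bounds bv.
    have TT := col_replaced_log_concave lam_gt0 b v.
    have T0 := col_replaced_gt0 lam_gt0 b v; have T0' := col_replaced_gt0 lam_gt0 v b.
    have L0 := Lw_ge0 v b.
    rewrite -(ler_pM2r P_gt0); apply: le_trans (ler_wpM2l (ltW T0) LT) _.
    have -> : T b v * (c * (L v b * T v b)) = c * L v b * (T b v * T v b) by ring.
    apply: le_trans (ler_wpM2l _ TT) _; first by rewrite mulr_ge0 // ltW.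
    by rewrite le_eqVlt; apply/orP; left; apply/eqP; ring.
  - by rewrite -/(T v v) col_replaced_id.
apply: (@le_trans _ _ (\sum_(p : {perm V} * {perm V}) \sum_u diag_prod lam p.1 * diag_prod lam p.2 *
  (2 * (fP p.1 - fN p.1 u) ^+ 2 + 2 * path_sqr u p))).
  apply: ler_sum => p _; rewrite (sum_porbits _ (fun O => (fP p.1 - fP (swap O p).1) ^+ 2)).
  rewrite mulr_sumr; apply: ler_sum => u _; apply: ler_wpM2l => //.
  have := slide_path_sqr fP fN u p; rewrite -/(path_sqr u p) /swap_at.
  set l := #|_|; set S := swap _ _; move=> H.
  (* The averaging weight 1/l cancels the path length in [H]; for the opening term the bound 1/l <=
     1 is enough. *)
  have l1 : 1 <= l%:R :> R by rewrite ler1n lt0n card_porbit_neq0.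
  rewrite mulrC ler_pdivrMr ?(lt_le_trans ltr01) //.
  have := sqr_ge0 (fP p.1 - fN p.1 u - (fN p.1 u - fP S.1)).
  have : 0 <= (l%:R - 1) * (fP p.1 - fN p.1 u) ^+ 2.
    by rewrite mulr_ge0 ?subr_ge0 // sqr_ge0.
  nra.
rewrite (_ : \sum_p _ = 2 * (P * open_energy) + 2 * \sum_u \sum_(p : {perm V} * {perm V}) lam u (p.1 u) *
  (hole_prod lam p.1 u * diag_prod lam p.2) * path_sqr u p).
  by move: path; lra.
have -> : P * open_energy = \sum_(p : {perm V} * {perm V}) diag_prod lam p.1 *
    diag_prod lam p.2 * \sum_u (fP p.1 - fN p.1 u) ^+ 2.
  rewrite /open_energy mulrC big_distrlr /= pair_bigA /=.
  by apply: eq_bigr => p _; rewrite -mulr_sumr; ring.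
rewrite [X in _ = _ + 2 * X]exchange_big /= !mulr_sumr -big_split /=.
apply: eq_bigr => p _; rewrite !mulr_sumr -[RHS]big_split; apply: eq_bigr => u _ /=.
by rewrite (diag_prodE lam p.1 u); ring.
Qed.


Definition perfect_mean : R := (\sum_s diag_prod lam s * fP s) / P.

Definition perfect_var : R := \sum_s diag_prod lam s * (fP s - perfect_mean) ^+ 2.

Lemma perfect_var_ge0 : 0 <= perfect_var.
Proof.
apply: sumr_ge0 => s _; apply: mulr_ge0; last exact: sqr_ge0.
exact: ltW (diag_prod_gt0 lam_gt0 s).
Qed.

(** The left side of [perfect_pairs_le] equals [2 * P * perfect_var], by expanding around the
    mean. *)
Lemma perfect_var_le : perfect_var <= 2 * open_energy + 2 * c * left_energy.
Proof.
pose g s := fP s - perfect_mean.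
have G0 : \sum_s diag_prod lam s * g s = 0.
  under eq_bigr => s _ do rewrite mulrBr.
  rewrite sumrB -mulr_suml -/P /perfect_mean mulrCA mulfV ?mulr1 ?subrr //.
  exact: lt0r_neq0.
have := perfect_pairs_le.
have -> : \sum_(p : {perm V} * {perm V}) diag_prod lam p.1 * diag_prod lam p.2 *
    (fP p.1 - fP p.2) ^+ 2 = 2 * P * perfect_var.
  transitivity (\sum_s \sum_t (diag_prod lam s * g s ^+ 2 * diag_prod lam t +
    diag_prod lam s * (diag_prod lam t * g t ^+ 2) -
    2 * (diag_prod lam s * g s) * (diag_prod lam t * g t))).
    by rewrite pair_bigA; apply: eq_bigr => p _; rewrite /g; ring.
  under eq_bigr => s _ do rewrite sumrB big_split /= -!mulr_sumr G0 mulr0 subr0.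
  by rewrite big_split /= -!mulr_suml -/P -/perfect_var; ring.
by move=> H; rewrite -(ler_pM2l P_gt0); move: H; lra.
Qed.

Lemma DL_ge0 u v : 0 <= DL lam w u v.
Proof. by apply: sumr_ge0 => a _; rewrite mulr_ge0 ?Lw_ge0 // ltW. Qed.

(** Summing over [u] first turns the [DL] part into a sum of [L v a * T v a] over [a != v], each
    term at most [c * P]. *)
Lemma left_hole_mass v :
  \sum_u (w u v + DL lam w u v) * minor lam u v <= 2 * c * n * P.
Proof.
have cP0 : 0 <= c * P by rewrite mulr_ge0 // ltW.
have cE : \sum_(u : V) c * P = c * n * P.
  by rewrite sumr_const -mulr_natr; ring.
under eq_bigr => u _ do rewrite mulrDl.
rewrite big_split /=.
have H1 : \sum_u w u v * minor lam u v <= c * n * P.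
  by rewrite -cE; apply: ler_sum => u _; exact: w_upper.
suff H2 : \sum_u DL lam w u v * minor lam u v <= c * n * P by lra.
under eq_bigr => u _ do rewrite mulr_suml.
rewrite exchange_big /= -cE big_mkcond /=; apply: ler_sum => a _.
case: ifP => // av; have [_] := Lw_bounds av; apply: le_trans.
rewrite [X in _ <= X]mulr_sumr le_eqVlt; apply/orP; left; apply/eqP.
by apply: eq_bigr => u _; ring.
Qed.

(** A punctured matching is paired with an independent perfect one and slid along their cycle
    through [u] to the swapped perfect matching. What remains is the variance over perfect
    matchings. *)
Lemma near_left_le :
  \sum_(s : {perm V}) \sum_u (w u (s u) + DL lam w u (s u)) *
    (hole_prod lam s u * (fN s u - perfect_mean) ^+ 2) <=
  n ^+ 2 * (16 * c ^+ 2 * left_energy + 12 * c * open_energy).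
Proof.
pose k u v := w u v + DL lam w u v.
have k0 u v : 0 <= k u v by rewrite addr_ge0 ?DL_ge0 // ltW.
have n0 : 0 <= n by [].
have path : \sum_u \sum_(p : {perm V} * {perm V}) k u (p.1 u) *
    (hole_prod lam p.1 u * diag_prod lam p.2) * path_sqr u p <=
    4 * c ^+ 2 * n * P * left_energy + 2 * c * n * P * open_energy.
  apply: path_sqr_sum_le => // [v b bv|v]; last exact: left_hole_mass.
  have [LT _] := Lw_bounds bv; have L0 := Lw_ge0 v b.
  (* Here the load is controlled for each [u] separately, so any weight [k] could be inserted before
     summing. *)
  have mb u : minor lam u b <= 2 * c * L v b * minor lam u v.
    have m0 := minor_gt0 lam_gt0 u b; have A := col_replaced_minor lam_gt0 u v b.
    rewrite -(ler_pM2r P_gt0); apply: le_trans (ler_wpM2l (ltW m0) LT) _.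
    have -> : minor lam u b * (c * (L v b * T v b)) = c * L v b * (T v b * minor lam u b).
      by ring.
    apply: le_trans (ler_wpM2l _ A) _; first by rewrite mulr_ge0 // ltW.
    by rewrite le_eqVlt; apply/orP; left; apply/eqP; ring.
  apply: (@le_trans _ _ (2 * c * L v b * \sum_u k u v * minor lam u v)).
    rewrite mulr_sumr; apply: ler_sum => u _; rewrite mulrCA.
    exact: ler_wpM2l.
  have cL : 0 <= 2 * c * L v b by rewrite !mulr_ge0 // ltW.
  apply: le_trans (ler_wpM2l cL (left_hole_mass v)) _.
  by rewrite le_eqVlt; apply/orP; left; apply/eqP; ring.
(* The swap at [u] carries a punctured and a perfect matching to a perfect and a punctured one of
   the same total weight, so the endpoint of the path is distributed as a perfect matching. *)
have swapped u : \sum_(p : {perm V} * {perm V}) k u (p.1 u) *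
    (hole_prod lam p.1 u * diag_prod lam p.2) * (fP (swap_at u p).1 - perfect_mean) ^+ 2 =
    (\sum_v k u v * minor lam u v) * perfect_var.
  rewrite (reindex_inj (inv_inj (@swap_atK V u))) /=.
  transitivity (\sum_(p : {perm V} * {perm V}) diag_prod lam p.1 *
    (fP p.1 - perfect_mean) ^+ 2 * (k u (p.2 u) * hole_prod lam p.2 u)).
    apply: eq_bigr => p _; rewrite -[(mix _ (mix _ _ _) _)]/((swap_at u (swap_at u p)).1).
    rewrite swap_atK -[mix _ p.1 p.2]/((swap_at u p).1) -[mix _ p.2 p.1]/((swap_at u p).2).
    have nS := stable_porbit p u.
    have e : (swap_at u p).1 u = p.2 u by rewrite swapE1 // porbit_id.
    have := diag_prod_swap_id lam nS; rewrite -/(swap_at u p).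
    rewrite (diag_prodE lam (swap_at u p).1 u) (diag_prodE lam p.2 u) e => E.
    have {}E : hole_prod lam (swap_at u p).1 u * diag_prod lam (swap_at u p).2 =
      diag_prod lam p.1 * hole_prod lam p.2 u.
      apply: (mulfI (lt0r_neq0 (lam_gt0 u (p.2 u)))).
      by rewrite mulrA E; ring.
    by rewrite E; ring.
  rewrite mulrC /perfect_var.
  have -> : \sum_v k u v * minor lam u v =
    \sum_(t : {perm V}) k u (t u) * hole_prod lam t u.
    rewrite [RHS](partition_big (fun t : {perm V} => t u) predT) //=.
    apply: eq_bigr => v _; rewrite mulr_sumr.
    by apply: eq_bigr => t /eqP ->.
  by rewrite big_distrlr /= pair_bigA.
rewrite -(ler_pM2l P_gt0).
set near := (X in P * X <= _).
have -> : P * near = \sum_u \sum_(p : {perm V} * {perm V}) k u (p.1 u) *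
    (hole_prod lam p.1 u * diag_prod lam p.2) * (fN p.1 u - perfect_mean) ^+ 2.
  rewrite mulrC /near big_distrlr /= pair_bigA [RHS]exchange_big /=.
  apply: eq_bigr => p _; rewrite mulr_suml; apply: eq_bigr => u _; rewrite /k; ring.
apply: (@le_trans _ _ (\sum_u (2 * n * (\sum_(p : {perm V} * {perm V}) k u (p.1 u) *
    (hole_prod lam p.1 u * diag_prod lam p.2) * path_sqr u p) +
    2 * ((\sum_v k u v * minor lam u v) * perfect_var)))).
  apply: ler_sum => u _; rewrite -swapped !mulr_sumr -[X in _ <= X]big_split /=.
  apply: ler_sum => p _.
  have W0 : 0 <= k u (p.1 u) * (hole_prod lam p.1 u * diag_prod lam p.2).
    by rewrite !mulr_ge0 // ltW ?hole_prod_gt0 ?diag_prod_gt0.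
  have H := slide_path_sqr fP fN u p; rewrite -/(path_sqr u p) in H.
  have H' : (fN p.1 u - fP (swap_at u p).1) ^+ 2 <= n * path_sqr u p.
    apply: le_trans H _; apply: ler_wpM2r; first exact: path_sqr_ge0.
    by rewrite ler_nat max_card.
  have := ler_wpM2l W0 (sqrD_le perfect_mean H'); rewrite /=; lra.
rewrite big_split /= -!mulr_sumr -mulr_suml [X in _ + 2 * (X * _)]exchange_big /=.
have V0 := perfect_var_ge0; have V1 := perfect_var_le.
have mass : \sum_v \sum_u k u v * minor lam u v <= 2 * c * n ^+ 2 * P.
  apply: (@le_trans _ _ (\sum_(v : V) 2 * c * n * P)).
    by apply: ler_sum => v _; exact: left_hole_mass.
  by rewrite sumr_const -mulr_natr le_eqVlt; apply/orP; left; apply/eqP; ring.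
have n2P : 0 <= 2 * c * n ^+ 2 * P.
  by apply: mulr_ge0; [rewrite !mulr_ge0 // ltW | exact: ltW].
(* The paths contribute [8 * c ^+ 2] and [4 * c] to the two coefficients, the variance of the
   endpoint [8 * c ^+ 2] and [8 * c]. *)
have MV := le_trans (ler_wpM2r V0 mass) (ler_wpM2l n2P V1).
have n2 : 0 <= 2 * n by rewrite mulr_ge0.
have := ler_wpM2l n2 path; move: MV; lra.
Qed.

End Comparison.

(** * Right slides as left slides of the transposed problem *)

Section Transposition.
Variables (R : realType) (V : finType) (lam w : V -> V -> R).
Variables (fP : {perm V} -> R) (fN : {perm V} -> V -> R).
Implicit Types (s t : {perm V}) (u v x y z : V).

Definition flip (a : V -> V -> R) y x := a x y.

Definition flip_fP s := fP s^-1%g.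

(** Exchanging the two sides inverts the permutation, and the missing edge is then named by its
    other endpoint. *)
Definition flip_fN s y := fN s^-1%g (s y).

Definition right_energy : R :=
  \sum_(s : {perm V}) \sum_z \sum_(x | x != z)
    hole_prod lam s z * (lam x (s z) * Rw lam w z x) *
    (fN s z - fN (tperm z x * s)%g z) ^+ 2.

Lemma reindex_flip (F : {perm V} -> V -> R) :
  \sum_s \sum_y F s y = \sum_s \sum_u F s^-1%g (s u).
Proof.
rewrite (reindex_inj invg_inj) /=; apply: eq_bigr => s _.
by rewrite (reindex_inj (@perm_inj _ s)).
Qed.

Lemma hole_prod_flip s u : hole_prod (flip lam) s^-1%g (s u) = hole_prod lam s u.
Proof.
rewrite /hole_prod (reindex_inj (@perm_inj _ s)) /=; apply: eq_big => x.
  by rewrite (inj_eq (@perm_inj _ s)).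
by rewrite /flip permK.
Qed.

Lemma diag_prod_flip s : diag_prod (flip lam) s^-1%g = diag_prod lam s.
Proof.
rewrite /diag_prod (reindex_inj (@perm_inj _ s)) /=; apply: eq_bigr => x _.
by rewrite /flip permK.
Qed.

Lemma minor_flip u v : minor (flip lam) v u = minor lam u v.
Proof.
rewrite /minor (reindex_inj invg_inj) /=; apply: eq_big => s.
  by apply/eqP/eqP => [<-|<-]; rewrite ?permK ?permKV.
by move=> /eqP <-; rewrite -{1}(permKV s v) hole_prod_flip.
Qed.

Lemma flip_fN_perm s u : flip_fN s^-1%g (s u) = fN s u.
Proof. by rewrite /flip_fN invgK permK. Qed.

Lemma flip_fP_perm s : flip_fP s^-1%g = fP s.
Proof. by rewrite /flip_fP invgK. Qed.

Lemma open_energy_flip :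
  open_energy (flip lam) flip_fP flip_fN = open_energy lam fP fN.
Proof.
rewrite /open_energy reindex_flip; apply: eq_bigr => s _; apply: eq_bigr => u _.
by rewrite diag_prod_flip flip_fN_perm flip_fP_perm.
Qed.

Lemma left_energy_flip :
  left_energy (flip lam) (flip w) flip_fN = right_energy.
Proof.
rewrite /left_energy reindex_flip; apply: eq_bigr => s _; apply: eq_bigr => u _.
rewrite (reindex_inj (@perm_inj _ s)) /=; apply: eq_big => x.
  by rewrite (inj_eq (@perm_inj _ s)).
move=> _; rewrite hole_prod_flip flip_fN_perm !permK; congr (_ * (_ - _) ^+ 2).
rewrite /flip_fN permM tpermR permK; congr fN.
(* Inversion moves the transposition to the other side; conjugating it by [s] brings it back as
   [tperm u x]. *)
rewrite invMg invgK tpermV; apply/permP => y; rewrite !permM.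
by rewrite (inj_tperm _ _ _ (@perm_inj _ s)).
Qed.

Lemma perfect_mean_flip : perfect_mean (flip lam) flip_fP = perfect_mean lam fP.
Proof.
rewrite /perfect_mean permanent_tr; congr (_ / _).
rewrite (reindex_inj invg_inj) /=; apply: eq_bigr => s _.
by rewrite diag_prod_flip flip_fP_perm.
Qed.

Lemma DL_flip u v : DL (flip lam) (flip w) v u = DR lam w u v.
Proof. by []. Qed.

End Transposition.

(** * The variance bound for all hole weights together *)

Section Total.
Variables (R : realType) (V : finType) (lam w : V -> V -> R) (c : R).
Hypothesis lam_gt0 : forall x y, 0 < lam x y.
Hypothesis w_gt0 : forall x y, 0 < w x y.
Hypothesis c_ge1 : 1 <= c.
Hypothesis w_lower : forall u v, permanent lam <= c * (w u v * minor lam u v).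
Hypothesis w_upper : forall u v, w u v * minor lam u v <= c * permanent lam.
Variables (fP : {perm V} -> R) (fN : {perm V} -> V -> R).
Local Notation n := (#|V|%:R : R).
Local Notation m := (perfect_mean lam fP).

Lemma near_right_le :
  \sum_(s : {perm V}) \sum_u (w u (s u) + DR lam w u (s u)) *
    (hole_prod lam s u * (fN s u - m) ^+ 2) <=
  n ^+ 2 * (16 * c ^+ 2 * right_energy lam w fN + 12 * c * open_energy lam fP fN).
Proof.
rewrite -left_energy_flip -open_energy_flip.
have H1 u v : permanent (flip lam) <= c * (flip w u v * minor (flip lam) u v).
  by rewrite permanent_tr minor_flip; exact: w_lower.
have H2 u v : flip w u v * minor (flip lam) u v <= c * permanent (flip lam).
  by rewrite permanent_tr minor_flip; exact: w_upper.
have lamT x y : 0 < flip lam x y by exact: lam_gt0.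
have wT x y : 0 < flip w x y by exact: w_gt0.
apply: le_trans (near_left_le lamT wT c_ge1 H1 H2 (flip_fP fP) (flip_fN fN)).
rewrite [X in _ <= X]reindex_flip perfect_mean_flip le_eqVlt; apply/orP; left; apply/eqP.
apply: eq_bigr => s _; apply: eq_bigr => u _.
by rewrite hole_prod_flip flip_fN_perm permK DL_flip.
Qed.

Lemma right_energy_ge0 : 0 <= right_energy lam w fN.
Proof.
rewrite -left_energy_flip; apply: left_energy_ge0 => x y; first exact: lam_gt0.
exact: w_gt0.
Qed.

Lemma hole_weighted_variance_le : (0 < #|V|)%N ->
  n ^+ 2 * perfect_var lam fP +
  \sum_(s : {perm V}) \sum_u W lam w u (s u) *
    (hole_prod lam s u * (fN s u - m) ^+ 2) <=
  32 * c ^+ 2 * n ^+ 2 *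
    (open_energy lam fP fN + left_energy lam w fN + right_energy lam w fN).
Proof.
move=> V0; have n1 : 1 <= n by rewrite ler1n.
have Lf := near_left_le lam_gt0 w_gt0 c_ge1 w_lower w_upper fP fN.
have Rt := near_right_le.
have Vr := perfect_var_le lam_gt0 w_gt0 c_ge1 w_lower w_upper fP fN.
have h0 s u : 0 <= hole_prod lam s u * (fN s u - m) ^+ 2.
  by apply: mulr_ge0; [exact: ltW (hole_prod_gt0 lam_gt0 s u) | exact: sqr_ge0].
(* Since [lam u (s u)] times the hole product is [diag_prod lam s], this part of [W] is compared
   with perfect matchings by a single opening move. *)
have Ed : \sum_(s : {perm V}) \sum_u n * lam u (s u) *
    (hole_prod lam s u * (fN s u - m) ^+ 2) <=
    2 * n * open_energy lam fP fN + 2 * n ^+ 2 * perfect_var lam fP.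
  have -> : 2 * n ^+ 2 * perfect_var lam fP = \sum_(s : {perm V}) \sum_(u : V)
      2 * n * (diag_prod lam s * (fP s - m) ^+ 2).
    rewrite /perfect_var mulr_sumr; apply: eq_bigr => s _.
    by rewrite sumr_const -mulr_natr; ring.
  rewrite /open_energy mulr_sumr -big_split /=; apply: ler_sum => s _.
  rewrite mulr_sumr -[X in _ <= X]big_split /=; apply: ler_sum => u _.
  have D0 : 0 <= n * diag_prod lam s by rewrite mulr_ge0 // ltW ?diag_prod_gt0.
  have D := diag_prodE lam s u.
  have -> : n * lam u (s u) * (hole_prod lam s u * (fN s u - m) ^+ 2) =
    n * diag_prod lam s * (fN s u - m) ^+ 2 by rewrite D; ring.
  have sq : (fN s u - m) ^+ 2 <= 2 * (fP s - fN s u) ^+ 2 + 2 * (fP s - m) ^+ 2.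
    by have := sqr_ge0 ((fN s u - fP s) - (fP s - m)); lra.
  by apply: le_trans (ler_wpM2l D0 sq) _; rewrite le_eqVlt; apply/orP; left; apply/eqP; ring.
have split : \sum_(s : {perm V}) \sum_u W lam w u (s u) *
    (hole_prod lam s u * (fN s u - m) ^+ 2) <=
  \sum_(s : {perm V}) \sum_u (w u (s u) + DL lam w u (s u)) *
    (hole_prod lam s u * (fN s u - m) ^+ 2) +
  \sum_(s : {perm V}) \sum_u (w u (s u) + DR lam w u (s u)) *
    (hole_prod lam s u * (fN s u - m) ^+ 2) +
  \sum_(s : {perm V}) \sum_u n * lam u (s u) *
    (hole_prod lam s u * (fN s u - m) ^+ 2).
  rewrite -!big_split /=; apply: ler_sum => s _.
  rewrite -!big_split /=; apply: ler_sum => u _.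
  rewrite -!mulrDl; apply: ler_wpM2r => //; rewrite /W.
  by have := w_gt0 u (s u); lra.
have O0 := open_energy_ge0 lam_gt0 fP fN.
have L0 := left_energy_ge0 lam_gt0 w_gt0 fN.
have R0 := right_energy_ge0.
move: O0 L0 R0 Vr Lf Rt Ed split.
set EO := open_energy _ _ _; set EL := left_energy _ _ _; set ER := right_energy _ _ _.
set VP := perfect_var _ _ => O0 L0 R0 Vr Lf Rt Ed split.
have n2 : 0 <= n ^+ 2 by rewrite exprn_ge0.
have c0 : 0 <= c by rewrite (le_trans ler01).
have nn : n <= n ^+ 2 by rewrite expr2 ler_peMl.
have cc : c <= c ^+ 2 by rewrite expr2 ler_peMl.
have c2 : 1 <= c ^+ 2 by rewrite expr_ge1.
(* The constant 32 is attained by the open energy: 6 from three copies of the perfect variance, 24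
   from the left and right bounds, 2 from [Ed]. *)
have := ler_wpM2l n2 Vr.
have X1 : n * EO <= n ^+ 2 * EO by apply: ler_wpM2r.
have X2 : n ^+ 2 * (c * EO) <= n ^+ 2 * (c ^+ 2 * EO).
  by apply: ler_wpM2l => //; apply: ler_wpM2r.
have X3 : n ^+ 2 * (c * EL) <= n ^+ 2 * (c ^+ 2 * EL).
  by apply: ler_wpM2l => //; apply: ler_wpM2r.
have X4 : n ^+ 2 * EO <= n ^+ 2 * (c ^+ 2 * EO).
  by apply: ler_wpM2l => //; rewrite -{1}[EO]mul1r; apply: ler_wpM2r.
have X5 : 0 <= n ^+ 2 * (c ^+ 2 * EL) by rewrite !mulr_ge0 // exprn_ge0.
have X6 : 0 <= n ^+ 2 * (c ^+ 2 * ER) by rewrite !mulr_ge0 // exprn_ge0.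
move: X1 X2 X3 X4 X5 X6 Lf Rt Ed split; lra.
Qed.

End Total.

(** * Relaxation time *)

Section Relaxation.
Variables (R : realType) (T : finType) (pi : T -> R) (P : T -> T -> R).

(** The relaxation time is the infimum of the admissible constants. Every ratio of variance to a
    positive Dirichlet form is a lower bound for them; that of [f0] makes the infimum positive. *)
Lemma relaxation_time_exists (K : R) (f0 : T -> R) :
  0 < K -> poincare pi P K -> (forall f, 0 <= dirichlet pi P f) ->
  0 < variance pi f0 ->
  exists2 tau : R, is_relaxation_time pi P tau & tau <= K.
Proof.
move=> K0 PK D0 V0.
pose E : classical_sets.set R := fun C => 0 < C /\ poincare pi P C.
have EK : E K by split.
have ratio_lb f : 0 < dirichlet pi P f ->
    classical_sets.lbound E (variance pi f / dirichlet pi P f).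
  by move=> Df C [_ PC]; rewrite ler_pdivrMr.
have Df0 : 0 < dirichlet pi P f0.
  rewrite lt_neqAle D0 andbT eq_sym; apply/negP => /eqP Df0.
  by have := PK f0; rewrite Df0 mulr0 leNgt V0.
have E0 : classical_sets.nonempty E by exists K.
have lbE : classical_sets.has_lbound E by exists (variance pi f0 / dirichlet pi P f0); exact: ratio_lb.
exists (inf E); last exact: ge_inf.
split=> [|f|C C0 PC]; last by apply: ge_inf.
  apply: lt_le_trans (lb_le_inf E0 (ratio_lb _ Df0)).
  exact: divr_gt0.
have [Df|Df] := ltP 0 (dirichlet pi P f).
  by rewrite -ler_pdivrMr //; apply: lb_le_inf => //; exact: ratio_lb.
have Df' : dirichlet pi P f = 0 by apply/eqP; rewrite eq_le Df D0.
by have := PK f; rewrite Df' !mulr0.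
Qed.

(** The mean minimises the quadratic deviation, so the mean over perfect matchings may serve as
    centre. *)
Lemma variance_le (f : T -> R) (m : R) :
  \sum_x pi x = 1 -> variance pi f <= \sum_x pi x * (f x - m) ^+ 2.
Proof.
move=> pi1; rewrite /variance; set mu := mean pi f.
have mu0 : \sum_x pi x * (f x - mu) = 0.
  under eq_bigr => x _ do rewrite mulrBr.
  by rewrite sumrB -mulr_suml pi1 mul1r subrr.
have -> : \sum_x pi x * (f x - m) ^+ 2 =
    \sum_x pi x * (f x - mu) ^+ 2 + (mu - m) ^+ 2.
  transitivity (\sum_x (pi x * (f x - mu) ^+ 2 + 2 * (mu - m) * (pi x * (f x - mu)) +
      pi x * (mu - m) ^+ 2)).
    by apply: eq_bigr => x _; ring.
  by rewrite !big_split /= -mulr_sumr mu0 mulr0 addr0 -mulr_suml pi1 mul1r.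
by rewrite lerDl sqr_ge0.
Qed.

Lemma variance_delta_gt0 (x0 x1 : T) : x0 != x1 ->
  (forall x, 0 < pi x) -> 0 < variance pi (fun x => (x == x0)%:R).
Proof.
move=> x01 pi0; rewrite /variance; set mu := mean pi _.
have x10 : x1 != x0 by rewrite eq_sym.
rewrite (bigD1 x0) //= (bigD1 x1) //= eqxx (negPf x10) /= sub0r sqrrN.
have rest : 0 <= \sum_(i | (i != x0) && (i != x1)) pi i * ((i == x0)%:R - mu) ^+ 2.
  by apply: sumr_ge0 => i _; apply: mulr_ge0; [exact: ltW | exact: sqr_ge0].
rewrite addrA ltr_wpDr //.
have [->|mu0] := eqVneq mu 0; first by rewrite subr0 expr1n expr0n mulr0 addr0 mulr1.
rewrite ltr_wpDl //; first by apply: mulr_ge0; [exact: ltW | exact: sqr_ge0].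
by rewrite mulr_gt0 // exprn_even_gt0.
Qed.

End Relaxation.

(** * Permutations and matchings *)

Section Encoding.
Variables (V1 V2 : finType) (h : V1 -> V2).
Hypothesis h_bij : bijective h.
Implicit Types (s t : {perm V1}) (u x y : V1) (v a : V2) (M : {set V1 * V2}).

Let h_inj : injective h := bij_inj h_bij.

Definition graph s : {set V1 * V2} := [set e | e.2 == h (s e.1)].

Definition punctured s u : {set V1 * V2} := graph s :\ (u, h (s u)).

Lemma in_graph s e : (e \in graph s) = (e.2 == h (s e.1)).
Proof. by rewrite inE. Qed.

Lemma in_punctured s u e : (e \in punctured s u) = (e.1 != u) && (e.2 == h (s e.1)).
Proof.
case: e => x a; rewrite !inE /= xpair_eqE negb_and.
have [->|xu] //= := eqVneq x u.
by case: eqP.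
Qed.

Lemma puncturedE s u : punctured s u = [set (x, h (s x)) | x in [pred x | x != u]].
Proof.
apply/setP => -[x a]; rewrite in_punctured /=; apply/andP/imsetP => [[xu /eqP->]|[y]].
  by exists x.
by rewrite inE => yu [-> ->].
Qed.

Lemma graphE s : graph s = [set (x, h (s x)) | x in V1].
Proof.
apply/setP => -[x a]; rewrite in_graph /=; apply/eqP/imsetP => [->|[y _ [-> ->]]] //.
by exists x.
Qed.

Lemma graph_inj : injective graph.
Proof.
move=> s t E; apply/permP => x; apply: h_inj.
by have := in_graph s (x, h (s x)); rewrite /= eqxx E in_graph => /eqP.
Qed.

Lemma graph_matching s M : M \subset graph s -> matching M.
Proof.
move=> /subsetP sub; apply/forall_inP => -[x a] /sub; rewrite in_graph /= => /eqP ->.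
apply/forall_inP => -[y b] /sub; rewrite in_graph /= => /eqP ->.
apply/implyP => /orP[/eqP->|/eqP /h_inj /perm_inj ->] //.
Qed.

Lemma graph_perfect s : graph s \in perfect V1 V2.
Proof.
rewrite inE (graph_matching (subxx _)) /=; apply/andP; split; apply/eqP/setP => x.
  rewrite !inE; apply/negbTE; rewrite negbK.
  by apply/imsetP; exists (x, h (s x)); rewrite ?in_graph.
rewrite !inE; apply/negbTE; rewrite negbK; have [g gK hK] := h_bij.
apply/imsetP; exists (s^-1%g (g x), x) => //.
by rewrite in_graph /= permKV hK.
Qed.

Lemma perfect_graph M : M \in perfect V1 V2 -> exists s, M = graph s.
Proof.
rewrite inE => /and3P[/forall_inP mM /eqP h1 /eqP h2].
have cov x : exists a, (x, a) \in M.
  have : x \notin holes1 M by rewrite h1 inE.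
  by rewrite inE negbK => /imsetP[[y a] ya ->]; exists a.
have uni x a y b : (x, a) \in M -> (y, b) \in M -> (x == y) || (a == b) -> (x, a) = (y, b).
  by move=> xa yb /= E; have /forall_inP /(_ _ yb) /implyP /(_ E) /eqP := mM _ xa.
have [f fM] : {f : V1 -> V2 | forall x, (x, f x) \in M}.
  by exists (fun x => xchoose (cov x)) => x; exact: (xchooseP (cov x)).
have [g gK hK] := h_bij.
have inj : injective (fun x => g (f x)).
  move=> x y /(can_inj hK) E.
  by have := uni _ _ _ _ (fM x) (fM y); rewrite E eqxx orbT => /(_ isT) [->].
exists (perm inj); apply/setP => -[x a]; rewrite in_graph /= permE hK.
apply/idP/eqP => [xa|->] //.
by have := uni _ _ _ _ xa (fM x); rewrite eqxx => /(_ isT) [].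
Qed.

Lemma card_graph s : #|graph s| = #|V1|.
Proof. by rewrite graphE card_imset // => x y []. Qed.

Lemma holes1_punctured s u : holes1 (punctured s u) = [set u].
Proof.
apply/setP => x; rewrite !inE; apply/idP/eqP => [|->].
  apply: contraNeq => xu; apply/imsetP; exists (x, h (s x)) => //.
  by rewrite in_punctured /= xu eqxx.
by apply/imsetP => -[[y a]]; rewrite in_punctured /= => /andP[yu _] E; rewrite E eqxx in yu.
Qed.

Lemma holes2_punctured s u : holes2 (punctured s u) = [set h (s u)].
Proof.
have [g gK hK] := h_bij.
apply/setP => a; rewrite !inE; apply/idP/eqP => [|->].
  apply: contraNeq => au; apply/imsetP; exists (s^-1%g (g a), a) => //.
  rewrite in_punctured /= permKV hK eqxx andbT.
  by apply: contraNneq au => <-; rewrite permKV hK.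
apply/imsetP => -[[y b]]; rewrite in_punctured /= => /andP[yu /eqP ->] /h_inj /perm_inj E.
by rewrite E eqxx in yu.
Qed.

Lemma in_near_perfect_punctured s u u' v' :
  (punctured s u \in near_perfect u' v') = (u' == u) && (v' == h (s u)).
Proof.
rewrite inE holes1_punctured holes2_punctured (graph_matching (subsetDl _ _)) /=.
have -> : #|punctured s u| == #|V1|.-1.
  by rewrite -(card_graph s) (cardsD1 (u, h (s u)) (graph s)) in_graph eqxx.
by rewrite /= !(inj_eq set1_inj) eq_sym [h _ == _]eq_sym.
Qed.

(** Joining the two holes by an edge gives a perfect matching, hence the graph of a permutation. *)
Lemma punctured_graph u v M : M \in near_perfect u v ->
  exists2 s : {perm V1}, h (s u) = v & M = punctured s u.
Proof.
rewrite inE => /and4P[/forall_inP mM _ /eqP h1 /eqP h2].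
have uM a : (u, a) \notin M.
  have : u \in holes1 M by rewrite h1 inE.
  by rewrite inE; apply: contra => uM; apply/imsetP; exists (u, a).
have Mv x : (x, v) \notin M.
  have : v \in holes2 M by rewrite h2 inE.
  by rewrite inE; apply: contra => xM; apply/imsetP; exists (x, v).
have /perfect_graph[s Es] : (u, v) |: M \in perfect V1 V2.
  rewrite inE; apply/and3P; split.
  - apply/forall_inP => e; rewrite in_setU1 => /orP[/eqP->|eM]; apply/forall_inP => f;
      rewrite in_setU1 => /orP[/eqP->|fM]; apply/implyP => /=.
    + by [].
    + case: f fM => y b fM /= /orP[/eqP E|/eqP E]; rewrite -E in fM.
        by rewrite (negPf (uM b)) in fM.
      by rewrite (negPf (Mv y)) in fM.
    + case: e eM => y b fM /= /orP[/eqP E|/eqP E]; rewrite E in fM.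
        by rewrite (negPf (uM b)) in fM.
      by rewrite (negPf (Mv y)) in fM.
    + by have /forall_inP /(_ _ fM) /implyP := mM _ eM.
  - rewrite -subset0; apply/subsetP => x; rewrite inE.
    move/negP; case; have [->|xu] := eqVneq x u.
      by apply/imsetP; exists (u, v); rewrite ?in_setU1 ?eqxx.
    have : x \notin holes1 M by rewrite h1 inE.
    rewrite inE negbK => /imsetP[e eM ->]; apply/imsetP; exists e => //.
    by rewrite in_setU1 eM orbT.
  - rewrite -subset0; apply/subsetP => a; rewrite inE.
    move/negP; case; have [->|av] := eqVneq a v.
      by apply/imsetP; exists (u, v); rewrite ?in_setU1 ?eqxx.
    have : a \notin holes2 M by rewrite h2 inE.
    rewrite inE negbK => /imsetP[e eM ->]; apply/imsetP; exists e => //.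
    by rewrite in_setU1 eM orbT.
have hv : h (s u) = v.
  by have := setU11 (u, v) M; rewrite Es in_graph /= => /eqP.
by exists s => //; rewrite /punctured -Es hv setU1K.
Qed.

End Encoding.

(** * The chain and its Dirichlet form in terms of permutations *)

Section Chain.
Variables (R : realType) (V1 V2 : finType) (h : V1 -> V2).
Hypothesis h_bij : bijective h.
Variables lam w : V1 -> V2 -> R.
Hypothesis lam_gt0 : forall u v, 0 < lam u v.
Hypothesis w_gt0 : forall u v, 0 < w u v.
Hypothesis V1_gt0 : (0 < #|V1|)%N.
Implicit Types (s t : {perm V1}) (u x y z : V1) (v a : V2) (M : {set V1 * V2}).

Let h_inj : injective h := bij_inj h_bij.

Local Notation n := (#|V1|%:R : R).
Local Notation lamh := (fun x y => lam x (h y)).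
Local Notation wh := (fun x y => w x (h y)).
Local Notation graph := (graph h).
Local Notation punctured := (punctured h).

Lemma big_graph (T : Type) (idx : T) (op : Monoid.com_law idx) (F : V1 * V2 -> T) s :
  \big[op/idx]_(e in graph s) F e = \big[op/idx]_x F (x, h (s x)).
Proof. by rewrite graphE big_imset //= => x y _ _ []. Qed.

Lemma big_punctured (T : Type) (idx : T) (op : Monoid.com_law idx) (F : V1 * V2 -> T) s u :
  \big[op/idx]_(e in punctured s u) F e = \big[op/idx]_(x | x != u) F (x, h (s x)).
Proof. by rewrite puncturedE big_imset //= => x y _ _ []. Qed.

Lemma activity_graph s : activity lam (graph s) = diag_prod lamh s.
Proof. exact: big_graph. Qed.

Lemma activity_punctured s u : activity lam (punctured s u) = hole_prod lamh s u.
Proof. exact: big_punctured. Qed.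

Lemma punctured_inj s t u x : punctured s u = punctured t x -> s = t /\ u = x.
Proof.
move=> E.
have : punctured s u \in near_perfect x (h (t x)).
  by rewrite E in_near_perfect_punctured // !eqxx.
rewrite in_near_perfect_punctured // => /andP[/eqP xu /eqP tx]; rewrite xu in E tx *.
split=> //; apply: (graph_inj h_bij).
have d (r : {perm V1}) : graph r = (u, h (r u)) |: punctured r u.
  by rewrite setD1K // in_graph.
by rewrite !d -E tx.
Qed.

Lemma punctured_notin_perfect s u : punctured s u \notin perfect V1 V2.
Proof.
rewrite inE holes1_punctured //; apply/negP => /and3P[_ /eqP/setP/(_ u)].
by rewrite !inE eqxx.
Qed.

Lemma in_Omega_graph s : graph s \in Omega V1 V2.
Proof. by rewrite inE graph_perfect. Qed.

Lemma in_Omega_punctured s u : punctured s u \in Omega V1 V2.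
Proof.
rewrite inE; apply/orP; right; apply/bigcupP; exists u => //.
by apply/bigcupP; exists (h (s u)); rewrite ?in_near_perfect_punctured ?eqxx.
Qed.

Lemma OmegaP M : M \in Omega V1 V2 ->
  (exists s, M = graph s) \/ (exists q : {perm V1} * V1, M = punctured q.1 q.2).
Proof.
rewrite inE => /orP[/(perfect_graph h_bij)|]; first by left.
move=> /bigcupP[u _ /bigcupP[v _ /(punctured_graph h_bij)[s _ ->]]].
by right; exists (s, u).
Qed.

Lemma sum_state (F : {set V1 * V2} -> R) :
  \sum_(M : state V1 V2) F (val M) =
  \sum_s F (graph s) + \sum_s \sum_u F (punctured s u).
Proof.
rewrite -(big_sub (Omega V1 V2) F) (bigID (mem (perfect V1 V2))) /=; congr (_ + _).
  rewrite -(big_imset F (in2W (graph_inj h_bij))) /=; apply: eq_bigl => M.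
  apply/andP/imsetP => [[_ /(perfect_graph h_bij)[s ->]]|[s _ ->]]; first by exists s.
  by rewrite in_Omega_graph graph_perfect.
pose pq (q : {perm V1} * V1) := punctured q.1 q.2.
have pq_inj : injective pq by move=> [s u] [t x] /punctured_inj /= [-> ->].
rewrite pair_bigA /= -(big_imset F (in2W pq_inj)) /=; apply: eq_bigl => M.
apply/andP/imsetP => [[/OmegaP[[s ->]|[q ->] _]]|[[s u] _ ->]].
- by rewrite graph_perfect.
- by exists q.
- by rewrite in_Omega_punctured punctured_notin_perfect.
Qed.

Lemma set_activity_perfect : set_activity lam (perfect V1 V2) = permanent lamh.
Proof.
rewrite /permanent; under [RHS]eq_bigr => s _ do rewrite -activity_graph.
rewrite -(big_imset _ (in2W (graph_inj h_bij))) /=; apply: eq_bigl => M.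
apply/idP/imsetP => [/(perfect_graph h_bij)[s ->]|[s _ ->]]; first by exists s.
exact: graph_perfect.
Qed.

Lemma set_activity_near u y :
  set_activity lam (near_perfect u (h y)) = minor lamh u y.
Proof.
rewrite /minor; under [RHS]eq_bigr => s _ do rewrite -activity_punctured.
rewrite -(@big_imset _ _ _ _ _ (fun s => punctured s u) [pred s : {perm V1} | s u == y]) /=; last first.
  by move=> s t _ _ /punctured_inj[].
apply: eq_bigl => M; apply/idP/imsetP => [/(punctured_graph h_bij)[s /h_inj E ->]|[s]].
  by exists s => //; rewrite inE E.
by rewrite inE => /eqP <- ->; rewrite in_near_perfect_punctured ?eqxx.
Qed.

Lemma reindex_h (P : pred V2) (F : V2 -> R) :
  \sum_(a | P a) F a = \sum_(y | P (h y)) F (h y).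
Proof. by rewrite (reindex h) //; exact: onW_bij. Qed.

Lemma Lw_h y z : Lw lam w (h y) (h z) = Lw lamh wh y z.
Proof. by rewrite /Lw (inj_eq h_inj). Qed.

Lemma Rw_h u x : Rw lam w u x = Rw lamh wh u x.
Proof. by rewrite /Rw reindex_h. Qed.

Lemma W_h u y : W lam w u (h y) = W lamh wh u y.
Proof.
rewrite /W /DL /DR reindex_h; congr (_ + _ + _).
  by apply: eq_big => z; rewrite ?(inj_eq h_inj) // Lw_h.
by apply: eq_bigr => x _; rewrite Rw_h.
Qed.

Lemma Lw_h_ge0 y z : 0 <= Lw lamh wh y z.
Proof. by apply: Lw_ge0. Qed.

Lemma Rw_h_ge0 u x : 0 <= Rw lamh wh u x.
Proof. by apply: (@Lw_ge0 _ _ (fun y x => lam x (h y)) (fun y x => w x (h y))). Qed.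

Lemma W_h_gt0 u y : 0 < W lamh wh u y.
Proof.
rewrite /W -!addrA ltr_wpDr // !addr_ge0 // ?mulr_ge0 ?ler0n //; first exact: ltW.
  by apply: sumr_ge0 => z _; rewrite mulr_ge0 ?Lw_h_ge0 // ltW.
by apply: sumr_ge0 => x _; rewrite mulr_ge0 ?Rw_h_ge0 // ltW.
Qed.

Lemma sum_holes s u (F : V1 -> V2 -> R) :
  \sum_u' \sum_(v' | punctured s u \in near_perfect u' v') F u' v' = F u (h (s u)).
Proof.
rewrite (bigD1 u) //= [X in _ + X]big1 ?addr0 => [|u' /negPf u'u].
  by apply: big_pred1 => v; rewrite in_near_perfect_punctured // eqxx.
by apply: big_pred0 => v; rewrite in_near_perfect_punctured // u'u.
Qed.

Lemma HWS_weight_graph s :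
  HWS_weight lam w (graph s) = n ^+ 2 * diag_prod lamh s.
Proof. by rewrite /HWS_weight graph_perfect // activity_graph. Qed.

Lemma HWS_weight_punctured s u :
  HWS_weight lam w (punctured s u) = W lamh wh u (s u) * hole_prod lamh s u.
Proof.
by rewrite /HWS_weight (negPf (punctured_notin_perfect s u)) sum_holes activity_punctured W_h.
Qed.

Lemma HWS_weight_gt0 (M : state V1 V2) : 0 < HWS_weight lam w (val M).
Proof.
have /OmegaP[[s ->]|[q ->]] := valP M.
  by rewrite HWS_weight_graph mulr_gt0 ?diag_prod_gt0 // exprn_gt0 // ltr0n.
by rewrite HWS_weight_punctured mulr_gt0 ?W_h_gt0 ?hole_prod_gt0.
Qed.

Local Notation Z := (\sum_(M : state V1 V2) HWS_weight lam w (val M)).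

Lemma Z_gt0 : 0 < Z.
Proof.
rewrite (bigD1 (Sub (graph 1%g) (in_Omega_graph 1%g))) //= ltr_wpDr //.
  by apply: sumr_ge0 => M _; exact: ltW (HWS_weight_gt0 M).
by have := HWS_weight_gt0 (Sub (graph 1%g) (in_Omega_graph 1%g)).
Qed.

Lemma pi_HWS_gt0 (M : state V1 V2) : 0 < pi_HWS lam w M.
Proof. by rewrite divr_gt0 ?HWS_weight_gt0 ?Z_gt0. Qed.

Lemma sum_pi_HWS : \sum_(M : state V1 V2) pi_HWS lam w M = 1.
Proof. by rewrite -mulr_suml mulfV // lt0r_neq0 ?Z_gt0. Qed.

(** Each move lands in exactly one state, so a sum over target states becomes a sum over moves. *)
Lemma sum_moves (A : {set V1 * V2}) (K : V1 * V2 -> {set V1 * V2})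
    (r : V1 * V2 -> R) (G : {set V1 * V2} -> R) :
  (forall e, e \in A -> K e \in Omega V1 V2) ->
  \sum_(M : state V1 V2) (\sum_(e in A | val M == K e) r e) * G (val M) =
  \sum_(e in A) r e * G (K e).
Proof.
move=> KA; under eq_bigr => M _ do rewrite mulr_suml.
rewrite (exchange_big_dep (mem A)) /=; last by move=> M e _ /andP[].
apply: eq_bigr => e eA.
rewrite (big_pred1 (Sub (K e) (KA e eA))) // => M.
by rewrite eA -val_eqE.
Qed.

Lemma slide_left_punctured s u x : x != u ->
  (u, h (s x)) |: (punctured s u :\ (x, h (s x))) = punctured (tperm u x * s)%g x.
Proof.
move=> xu; apply/setP => -[y a]; rewrite in_setU1 in_setD1 !in_punctured /=.
rewrite !xpair_eqE permM; case: tpermP => [->|->|/eqP/negPf yu /eqP/negPf yx].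
- by rewrite eqxx /= andbF orbF [u == x]eq_sym xu.
- by rewrite eqxx (negPf xu) /=; case: eqP.
- by rewrite yu yx.
Qed.

Lemma slide_right_punctured s u x : x != u ->
  (x, h (s u)) |: (punctured s u :\ (x, h (s x))) = punctured (tperm u x * s)%g u.
Proof.
move=> xu; apply/setP => -[y a]; rewrite in_setU1 in_setD1 !in_punctured /=.
rewrite !xpair_eqE permM; case: tpermP => [->|->|/eqP/negPf yu /eqP/negPf yx].
- by rewrite eqxx /= andbF [u == x]eq_sym (negPf xu).
- by rewrite eqxx (negPf xu) /=; case: (a =P h (s x)) => _; rewrite ?andbF ?orbF.
- by rewrite yu yx.
Qed.

Variable f : state V1 V2 -> R.

(** The default 0 outside [Omega] lets [f] be evaluated at edge sets without carrying membership
    proofs. *)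
Definition extend M : R := if insub M is Some m then f m else 0.

Lemma extend_val (m : state V1 V2) : extend (val m) = f m.
Proof. by rewrite /extend valK. Qed.

Definition exit_energy M : R :=
  \sum_(m : state V1 V2) rate lam w M (val m) * (extend M - extend (val m)) ^+ 2.

Let fP s := extend (graph s).
Let fN s u := extend (punctured s u).

Lemma dirichlet_exit :
  Z * dirichlet (pi_HWS lam w) (P_HWS lam w) f =
  2^-1 * (\sum_(s : {perm V1}) n ^+ 2 * diag_prod lamh s * exit_energy (graph s) +
    \sum_(s : {perm V1}) \sum_u W lamh wh u (s u) * hole_prod lamh s u * exit_energy (punctured s u)).
Proof.
rewrite /dirichlet mulrCA; congr (_ * _).
transitivity (\sum_(M : state V1 V2) HWS_weight lam w (val M) * exit_energy (val M)).
  rewrite mulr_sumr; apply: eq_bigr => M _; rewrite /exit_energy !mulr_sumr.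
  apply: eq_bigr => M' _; rewrite !extend_val /P_HWS.
  (* Self-loops contribute nothing, so [P_HWS] may be replaced by [rate]. *)
  case: eqP => [->|_]; first by rewrite subrr expr0n !mulr0.
  by rewrite /pi_HWS; field; exact: lt0r_neq0 Z_gt0.
rewrite (sum_state (fun M => HWS_weight lam w M * exit_energy M)); congr (_ + _).
  by apply: eq_bigr => s _; rewrite HWS_weight_graph.
by apply: eq_bigr => s _; apply: eq_bigr => u _; rewrite HWS_weight_punctured.
Qed.

Lemma exit_energy_graph s :
  exit_energy (graph s) = (2 * n)^-1 * \sum_u (fP s - fN s u) ^+ 2.
Proof.
rewrite /exit_energy; under eq_bigr => M _ do rewrite /rate graph_perfect // /rate_perfect.
rewrite (sum_moves (fun _ => (2 * n)^-1) (fun M => (extend (graph s) - extend M) ^+ 2)).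
  by rewrite big_graph mulr_sumr.
by case=> x a; rewrite in_graph /= => /eqP ->; exact: in_Omega_punctured.
Qed.

(** Only the slides are kept; the closing moves, reverses of the openings in [exit_energy_graph],
    are dropped as nonnegative. *)
Lemma exit_energy_punctured s u :
  \sum_(x | x != u) lamh u (s x) * Lw lamh wh (s u) (s x) / (2 * W lamh wh u (s u)) *
    (fN s u - fN (tperm u x * s)%g x) ^+ 2 +
  \sum_(x | x != u) lamh x (s u) * Rw lamh wh u x / (2 * W lamh wh u (s u)) *
    (fN s u - fN (tperm u x * s)%g u) ^+ 2 <= exit_energy (punctured s u).
Proof.
rewrite /exit_energy.
pose G M := (extend (punctured s u) - extend M) ^+ 2.
pose v := h (s u).
pose A M := if M == (u, v) |: punctured s u then n * lam u v / (2 * W lam w u v) else 0.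
pose B (e : V1 * V2) := lam u e.2 * Lw lam w v e.2 / (2 * W lam w u v).
pose C (e : V1 * V2) := lam e.1 v * Rw lam w u e.1 / (2 * W lam w u v).
have rateE M : rate lam w (punctured s u) M = A M +
    \sum_(e in punctured s u | M == (u, e.2) |: (punctured s u :\ e)) B e +
    \sum_(e in punctured s u | M == (e.1, v) |: (punctured s u :\ e)) C e.
  by rewrite /rate (negPf (punctured_notin_perfect s u)) sum_holes.
under [X in _ <= X]eq_bigr => M _ do rewrite rateE mulrDl mulrDl.
rewrite big_split big_split /=.
rewrite (sum_moves B G) => [|e]; last first.
  rewrite in_punctured; case: e => x a /= /andP[xu /eqP ->].
  by rewrite slide_left_punctured // in_Omega_punctured.
rewrite (sum_moves C G) => [|e]; last first.
  rewrite in_punctured; case: e => x a /= /andP[xu /eqP ->].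
  by rewrite slide_right_punctured // in_Omega_punctured.
rewrite !big_punctured -addrA ler_wpDl //.
  apply: sumr_ge0 => M _; apply: mulr_ge0; last exact: sqr_ge0.
  rewrite /A; case: ifP => // _; rewrite W_h divr_ge0 ?mulr_ge0 ?ler0n //.
    exact: ltW.
  exact: ltW (W_h_gt0 _ _).
rewrite le_eqVlt; apply/orP; left; apply/eqP; congr (_ + _).
  apply: eq_bigr => x xu; rewrite /B /G /= slide_left_punctured //.
  by rewrite Lw_h W_h.
apply: eq_bigr => x xu; rewrite /C /G /= slide_right_punctured //.
by rewrite Rw_h W_h.
Qed.

Lemma dirichlet_ge :
  open_energy lamh fP fN + left_energy lamh wh fN + right_energy lamh wh fN <=
  4 * (Z * dirichlet (pi_HWS lam w) (P_HWS lam w) f).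
Proof.
rewrite dirichlet_exit.
have n1 : 1 <= n by rewrite ler1n.
have n0 : n != 0 by rewrite lt0r_neq0 // (lt_le_trans ltr01).
(* By [exit_energy_graph] the right side is [n] times the open energy; the factor [n] is
   discarded. *)
have H1 : open_energy lamh fP fN <=
    2 * \sum_(s : {perm V1}) n ^+ 2 * diag_prod lamh s * exit_energy (graph s).
  rewrite /open_energy mulr_sumr; apply: ler_sum => s _.
  rewrite -mulr_sumr exit_energy_graph.
  set D := diag_prod _ s; set S := \sum_u _.
  have DS : 0 <= D * S.
    apply: mulr_ge0; first exact: ltW (diag_prod_gt0 _ _).
    by apply: sumr_ge0 => u _; exact: sqr_ge0.
  have -> : 2 * (n ^+ 2 * D * ((2 * n)^-1 * S)) = n * (D * S) by field.
  by rewrite ler_peMl.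
suff H2 : left_energy lamh wh fN + right_energy lamh wh fN <= 2 * \sum_(s : {perm V1}) \sum_u
    W lamh wh u (s u) * hole_prod lamh s u * exit_energy (punctured s u) by lra.
rewrite /left_energy /right_energy mulr_sumr -big_split /=; apply: ler_sum => s _.
rewrite mulr_sumr -big_split /=; apply: ler_sum => u _.
have W0 := W_h_gt0 u (s u); have h0 : 0 < hole_prod lamh s u by exact: hole_prod_gt0.
have Wn : W lamh wh u (s u) != 0 by exact: lt0r_neq0.
have c0 : 0 <= 2 * (W lamh wh u (s u) * hole_prod lamh s u).
  by rewrite !mulr_ge0 // ltW.
rewrite mulrA; apply: le_trans (ler_wpM2l c0 (exit_energy_punctured s u)).
rewrite mulrDr !mulr_sumr le_eqVlt; apply/orP; left; apply/eqP.
by congr (_ + _); apply: eq_bigr => x _; field.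
Qed.

Lemma dirichlet_ge0 : 0 <= dirichlet (pi_HWS lam w) (P_HWS lam w) f.
Proof.
have O0 : 0 <= open_energy lamh fP fN by apply: open_energy_ge0.
have L0 : 0 <= left_energy lamh wh fN by apply: left_energy_ge0.
have R0 : 0 <= right_energy lamh wh fN by apply: right_energy_ge0.
rewrite -(pmulr_rge0 _ Z_gt0) -(pmulr_rge0 _ (ltr0Sn R 3)).
by apply: le_trans dirichlet_ge; rewrite !addr_ge0.
Qed.

End Chain.

(** * The Poincare inequality and the relaxation time of the chain *)

Lemma eq_card_bij (T1 T2 : finType) :
  #|T1| = #|T2| -> exists h : T1 -> T2, bijective h.
Proof.
move=> E; exists (fun x => enum_val (cast_ord E (enum_rank x))).
exists (fun y => enum_val (cast_ord (esym E) (enum_rank y))) => x.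
  by rewrite enum_valK cast_ordK enum_rankK.
by rewrite enum_valK cast_ordKV enum_rankK.
Qed.

(** The constant 128 is 32 from [hole_weighted_variance_le] times 4 from [dirichlet_ge]; the
    normalisation [Z] cancels. *)
Lemma HWS_poincare (R : realType) (V1 V2 : finType) (lam w : V1 -> V2 -> R) (c : R) :
  1 <= c -> (0 < #|V1|)%N -> #|V1| = #|V2| ->
  (forall u v, 0 < lam u v) -> (forall u v, 0 < w u v) -> rough lam w c ->
  poincare (pi_HWS lam w) (P_HWS lam w) (128 * c ^+ 2 * #|V1|%:R ^+ 2).
Proof.
move=> c1 V0 /eq_card_bij[h h_bij] lam0 w0 rgh f.
have c0 : 0 < c by exact: lt_le_trans c1.
pose lamh x y := lam x (h y); pose wh x y := w x (h y).
have lamh0 x y : 0 < lamh x y by exact: lam0.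
have P0 := permanent_gt0 lamh0.
have rghh x y : c^-1 <= wh x y * minor lamh x y / permanent lamh <= c.
  have := rgh x (h y); rewrite /ideal_weight (set_activity_perfect h_bij) (set_activity_near h_bij).
  by rewrite invf_div mulrA.
have lower x y : permanent lamh <= c * (wh x y * minor lamh x y).
  have /andP[+ _] := rghh x y.
  by rewrite ler_pdivlMr // ler_pdivrMl.
have upper x y : wh x y * minor lamh x y <= c * permanent lamh.
  by have /andP[_] := rghh x y; rewrite ler_pdivrMr.
pose fP s := extend f (graph h s); pose fN s u := extend f (punctured h s u).
pose m := perfect_mean lamh fP.
have Z0 := Z_gt0 h_bij lam0 w0 V0.
set Z := \sum_(M : _) _ in Z0.
have D := dirichlet_ge h_bij lam0 w0 V0 f.
have wh0 x y : 0 < wh x y by exact: w0.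
have H := hole_weighted_variance_le lamh0 wh0 c1 lower upper fP fN V0.
have V := variance_le f m (sum_pi_HWS h_bij lam0 w0 V0).
apply: le_trans V _; rewrite -(ler_pM2l Z0).
have -> : Z * (\sum_x pi_HWS lam w x * (f x - m) ^+ 2) =
    #|V1|%:R ^+ 2 * perfect_var lamh fP +
    \sum_(s : {perm V1}) \sum_u W lamh wh u (s u) *
      (hole_prod lamh s u * (fN s u - m) ^+ 2).
  transitivity (\sum_(M : state V1 V2)
      HWS_weight lam w (val M) * (extend f (val M) - m) ^+ 2).
    rewrite mulr_sumr; apply: eq_bigr => M _; rewrite extend_val /pi_HWS -/Z.
    by field; exact: lt0r_neq0.
  rewrite (sum_state h_bij (fun M => HWS_weight lam w M * (extend f M - m) ^+ 2)).
  congr (_ + _).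
    rewrite /perfect_var mulr_sumr; apply: eq_bigr => s _.
    by rewrite (HWS_weight_graph h_bij) -mulrA.
  apply: eq_bigr => s _; apply: eq_bigr => u _.
  by rewrite (HWS_weight_punctured h_bij) -mulrA.
apply: le_trans H _.
have cn : 0 <= 32 * c ^+ 2 * #|V1|%:R ^+ 2 by rewrite !mulr_ge0 ?exprn_ge0 // ltW.
apply: le_trans (ler_wpM2l cn D) _.
by rewrite le_eqVlt; apply/orP; left; apply/eqP; rewrite -/Z; ring.
Qed.

Theorem lemma8 (R : realType) (c : R) (hc : 1 <= c) :
  exists C : R,
    forall (n : nat) (V1 V2 : finType) (lam w : V1 -> V2 -> R),
      (2 <= n)%N -> #|V1| = n -> #|V2| = n ->
      (forall u v, 0 < lam u v) ->
      (forall u v, 0 < w u v) ->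
      rough lam w c ->
      exists2 tau : R,
        is_relaxation_time (pi_HWS lam w) (P_HWS lam w) tau
        & tau <= C * n%:R ^+ 2 * ln n%:R.
Proof.
have ln2 : 0 < ln 2%:R :> R by rewrite ln_gt0 // ltr1n.
(* Since [n] is at least 2, [ln n / ln 2] is at least 1, so the logarithm is inserted at the cost of
   dividing by [ln 2]. *)
exists (128 * c ^+ 2 / ln 2%:R) => n V1 V2 lam w n2 E1 E2 lam0 w0 rgh.
have n0 : (0 < n)%N by exact: ltnW.
have V0 : (0 < #|V1|)%N by rewrite E1.
have c0 : 0 < c by exact: lt_le_trans hc.
have E12 : #|V1| = #|V2| by rewrite E1 E2.
have PK := HWS_poincare hc V0 E12 lam0 w0 rgh.
have [h h_bij] := eq_card_bij E12.
have K0 : 0 < 128 * c ^+ 2 * #|V1|%:R ^+ 2 :> R.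
  by rewrite !mulr_gt0 ?exprn_gt0 ?ltr0n.
have /card_gt0P[u _] := V0.
(* Two distinct states, one perfect and one punctured, yield a function of positive variance. *)
pose x0 : state V1 V2 := Sub (graph h 1%g) (in_Omega_graph h_bij 1%g).
pose x1 : state V1 V2 := Sub (punctured h 1%g u) (in_Omega_punctured h_bij 1%g u).
have x01 : x0 != x1.
  rewrite -val_eqE /=; apply/eqP => E; have := punctured_notin_perfect h 1%g u.
  by rewrite -E (graph_perfect h_bij).
have D0 f : 0 <= dirichlet (pi_HWS lam w) (P_HWS lam w) f.
  by apply: (dirichlet_ge0 h_bij).
have [tau Htau tauK] := relaxation_time_exists K0 PK D0
  (variance_delta_gt0 x01 (pi_HWS_gt0 h_bij lam0 w0 V0)).
exists tau => //; apply: le_trans tauK _; rewrite E1.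
have -> : 128 * c ^+ 2 / ln 2%:R * n%:R ^+ 2 * ln n%:R =
  128 * c ^+ 2 * n%:R ^+ 2 * (ln n%:R / ln 2%:R) by field; exact: lt0r_neq0.
rewrite ler_peMr //; first by rewrite !mulr_ge0 ?exprn_ge0 // ltW.
by rewrite ler_pdivlMr // mul1r ler_ln ?posrE ?ltr0n // ler_nat.
Qed.
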